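(* Fix a small constant $\varepsilon>0$. For each $n$, let $X$ and $Y$ be independent random graphs with $X\in\mathcal{G}(n,p_1)$ and $Y\in\mathcal{G}(n,p_2)$, where $p_1=p_1(n)$ and $p_2=p_2(n)$ depend on $n$. Let $p_0=\frac{\exp\left(2(\log n)^{2/3}\right)}{n^{1/2}}$. \begin{enumerate} \item If either (i) $p_1p_2\le \frac{(1-\varepsilon)/2}{n}$ and both $p_1,p_2\gg \frac{\log n}{n}$ (i.e. $\frac{\log n}{n}=o(p_1)$ and $\frac{\log n}{n}=o(p_2)$), or (ii) $\min\{p_1,p_2\}\le \frac{\log n+c(n)}{n}$ for some function $c(n)\to-\infty$, then $\mathsf{FS}(X,Y)$ is disconnected with high probability. \item If $p_1p_2\ge p_0^2$ and $p_1,p_2\ge \frac{2}{(\log n)^{1/3}}\,p_0$, then $\mathsf{FS}(X,Y)$ is connected with high probability. \end{enumerate}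
   Context: All graphs are finite and simple. For graphs $X$ and $Y$ each with $n$ vertices, the friends-and-strangers graph $\mathsf{FS}(X,Y)$ is the graph whose vertex set is the set of all bijections $\sigma:V(X)\to V(Y)$, where two bijections $\sigma,\sigma'$ are adjacent if and only if there exist $a,b\in V(X)$ with $\{a,b\}\in E(X)$ such that $\{\sigma(a),\sigma(b)\}\in E(Y)$, $\sigma'(a)=\sigma(b)$, $\sigma'(b)=\sigma(a)$, and $\sigma'(c)=\sigma(c)$ for all $c\in V(X)\setminus\{a,b\}$. $\mathcal{G}(n,p)$ denotes the Erdős–Rényi random graph on $n$ vertices in which each pair is an edge independently with probability $p$. A sequence of events $\mathcal{A}_n$ holds with high probability if $\Pr(\mathcal{A}_n)\to1$ as $n\to\infty$. $\log$ is the natural logarithm. *)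

(* Defs.v *)
From HB Require Import structures.
From mathcomp Require Import all_boot all_order all_algebra all_fingroup.
From mathcomp Require Import all_classical all_reals all_analysis.
Set Implicit Arguments. Unset Strict Implicit. Unset Printing Implicit Defensive.
Import Order.TTheory GRing.Theory Num.Theory.
Local Open Scope ring_scope.

(* A simple graph on the vertex set 'I_n is encoded by its edge set, a subset
   of the set of potential edges (i,j) with i < j (each unordered pair {i,j}
   is represented once, by its ordered version with the smaller endpoint first). *)
Definition all_pairs (n : nat) : {set 'I_n * 'I_n} :=
  [set e : 'I_n * 'I_n | (e.1 < e.2)%N].

Definition is_graph (n : nat) (E : {set 'I_n * 'I_n}) : bool :=
  E \subset all_pairs n.

Definition adj (n : nat) (E : {set 'I_n * 'I_n}) (a b : 'I_n) : bool :=
  ((a, b) \in E) || ((b, a) \in E).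

Definition fs_edge (n : nat) (X Y : {set 'I_n * 'I_n}) : rel {perm 'I_n} :=
  fun s t => [exists a : 'I_n, exists b : 'I_n,
    [&& adj X a b, adj Y (s a) (s b) &
        [forall c : 'I_n, t c == (if c == a then s b
                                  else if c == b then s a else s c)]]].

Definition FS_connected (n : nat) (X Y : {set 'I_n * 'I_n}) : bool :=
  [forall s : {perm 'I_n}, forall t : {perm 'I_n}, connect (fs_edge X Y) s t].

Definition gnp_weight (R : realType) (n : nat) (p : R) (E : {set 'I_n * 'I_n}) : R :=
  p ^+ #|E| * (1 - p) ^+ (#|all_pairs n| - #|E|).

Definition prob_FS_connected (R : realType) (n : nat) (p1 p2 : R) : R :=
  \sum_(X in powerset (all_pairs n))
    \sum_(Y in powerset (all_pairs n))
      (if FS_connected X Y then gnp_weight p1 X * gnp_weight p2 Y else 0).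

Definition prob_FS_disconnected (R : realType) (n : nat) (p1 p2 : R) : R :=
  \sum_(X in powerset (all_pairs n))
    \sum_(Y in powerset (all_pairs n))
      (if ~~ FS_connected X Y then gnp_weight p1 X * gnp_weight p2 Y else 0).

Definition p0 (R : realType) (n : nat) : R :=
  expR (2 * (ln (n%:R : R)) `^ (2 / 3)) / (n%:R : R) `^ (1 / 2).

(* Main.v *)
(** Part 1. If the maximum degrees satisfy [2 d1 d2 < n], then the two graphs pack
    edge-disjointly (Sauer--Spencer) and the packing is an isolated vertex of [FS]; below
    the threshold [log n / n], the second moment method gives an isolated vertex of [X] or
    [Y], whose occupant (or position) never changes.

    Part 2. Think of [s : {perm 'I_n}] as people [s x] standing at positions [x].  A person
    [r] walks freely along the edges of [X] inside the set of the positions of the friends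
    of [r].  This set has about [n p] elements and is large compared with the sizes
    [log n / p] above which all pairs of sets are joined by an edge, so [X] restricted to it
    has a giant component (its core).  For a fixed [s], the event that a given position is
    not adjacent to the core of some given person has probability [exp (- n p ^ 2)] up to
    logarithmic factors in the exponent, and these events are independent enough for a
    union bound over all [n!] bijections to show that, simultaneously for all [s], all but a
    small fraction of the positions are adjacent to all the cores at once.  Three such walks
    bring someone from any moderately large set of people to some place of any moderately
    large set of positions (lemma [relay]); four such relays bring any person to any
    position without touching two prescribed positions (lemma [transport]).  A common friend
    of the people at the ends [a], [b] of an edge is thus brought to a common neighbour of
    [a] and [b], where a triangle allows the exchange of these two people, and then
    everything else is undone.  Hence [FS (X, Y)] is connected as soon as [n p ^ 2] exceeds
    a power of [log n]. *)

Require Import Defs.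
From HB Require Import structures.
From mathcomp Require Import all_boot all_order all_algebra all_fingroup.
From mathcomp Require Import zify ring lra.
Set Implicit Arguments. Unset Strict Implicit. Unset Printing Implicit Defensive.

(** * Linked graphs and their cores *)

Lemma leq_card_bigcup (I T : finType) (P : pred I) (F : I -> {set T}) k :
  (forall i, P i -> #|F i| <= k) -> #|\bigcup_(i | P i) F i| <= #|P| * k.
Proof.
move=> Fk; rewrite -sum_nat_const; apply: leq_trans (leq_sum _ Fk).
apply: (big_ind2 (fun (A : {set T}) m => #|A| <= m)); rewrite ?cards0 //.
by move=> A m B p Am Bp; rewrite (leq_trans (leq_card_setU A B)) ?leq_add.
Qed.

Lemma set_sized_subset (V : finType) (S : {set V}) k : k <= #|S| ->
  exists2 A : {set V}, A \subset S & #|A| = k.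
Proof.
move=> kS; have /card_gt0P[A] : 0 < #|[set A : {set V} | A \subset S & #|A| == k]|.
  by rewrite cards_draws bin_gt0.
by rewrite inE => /andP[? /eqP ?]; exists A.
Qed.

Section Cores.
Variables (V : finType) (e : rel V).
Hypothesis e_sym : symmetric e.
Implicit Types (S K A B G : {set V}).

(** A quasi-randomness condition. [A] and [B] may meet, so it applies to two components of one set
    before they are known to be distinct. *)
Definition linked (th : nat) := forall A B : {set V},
  th <= #|A| -> th <= #|B| -> exists x y, [/\ x \in A, y \in B & e x y].

Definition nbh (x : V) : {set V} := [set y | e x y].

Definition within (S : {set V}) : rel V := [rel x y | [&& x \in S, y \in S & e x y]].

Definition comp (S : {set V}) (x : V) : {set V} := [set y | connect (within S) x y].

(** When [e] is linked with threshold [th], this is the giant component of [S]. Selecting vertices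
    by the size of their component avoids choosing that component. *)
Definition core (th : nat) (S : {set V}) : {set V} :=
  [set x in S | th <= #|comp S x|].

Definition attached (K : {set V}) (x : V) : bool := [exists k in K, e x k].

Lemma within_connect_sym S : connect_sym (within S).
Proof.
by apply: sym_connect_sym => x y; rewrite /within /= e_sym andbCA.
Qed.

Lemma within_connectS S (S1 : {set V}) x y :
  S \subset S1 -> connect (within S) x y -> connect (within S1) x y.
Proof.
move=> /subsetP sub; apply: (connect_sub _) => u v /and3P[uS vS uv].
by apply: connect1; rewrite /within /= !sub.
Qed.

Lemma connect_within S x y : x \in S -> connect (within S) x y -> y \in S.
Proof.
move=> xS /connectP[p]; elim: p x xS => [|z p IH] x xS /= => [_ -> //|].
by case/andP=> /and3P[_ zS _]; apply: IH.
Qed.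

Lemma coreS th S : core th S \subset S.
Proof. by apply/subsetP => x; rewrite inE => /andP[]. Qed.

(** The components of [x] and [y] both have [th] vertices, so linkedness puts an edge between
    them. *)
Lemma core_connect th S x y : linked th ->
  x \in core th S -> y \in core th S -> connect (within S) x y.
Proof.
move=> lk; rewrite !inE => /andP[xS cx] /andP[yS cy].
have [x' [y' []]] := lk _ _ cx cy.
rewrite !inE => xx' yy' exy; apply: (connect_trans xx').
apply: (@connect_trans _ _ y'); last by rewrite within_connect_sym.
apply: connect1; rewrite /within /=.
by rewrite exy (connect_within xS xx') (connect_within yS yy').
Qed.

(* A minimal union of components among those with at least [th] vertices is a
   single component, and linkedness leaves fewer than [th] vertices outside. *)
Lemma core_card th S : linked th -> 3 * th <= #|S| -> #|S| <= #|core th S| + th.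
Proof.
move=> lk leS.
pose closd (W : {set V}) := [&& W \subset S, th <= #|W| &
  [forall x in W, forall y in S, e x y ==> (y \in W)]].
have cS : closd S.
  rewrite /closd subxx /=; apply/andP; split; first by lia.
  by apply/'forall_implyP => x xS; apply/'forall_implyP=> y yS; apply/implyP.
case: (arg_minnP (fun W : {set V} => #|W|) cS) => W /and3P[WS cW /'forall_implyP clW] minW.
have {clW}clW x y : x \in W -> y \in S -> e x y -> y \in W.
  by move=> xW yS; have /'forall_implyP/(_ y yS)/implyP := clW x xW.
have cD : #|S :\: W| < th.
  rewrite ltnNge; apply/negP => cD; have [x [y [xW]]] := lk _ _ cW cD.
  by rewrite inE => /andP[/negP yW yS] exy; apply: yW; apply: clW exy.
have cSD : #|S| = #|W| + #|S :\: W|.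
  by rewrite -(cardsID W S) (setIidPr WS).
suff /subset_leq_card : W \subset core th S by lia.
apply/subsetP => x xW; have xS := subsetP WS x xW; rewrite inE xS /= leqNgt.
apply/negP => small.
have compW : comp S x \subset W.
  apply/subsetP => y; rewrite inE => /connectP[p]; elim: p x xW {xS small} => [|z p IH] x xW /=.
    by move=> _ ->.
  by case/andP=> /and3P[_ zS xz]; apply: IH; apply: clW xz.
have cWD : #|W| = #|comp S x| + #|W :\: comp S x|.
  by rewrite -(cardsID (comp S x) W) (setIidPr compW).
have cx : 0 < #|comp S x| by apply/card_gt0P; exists x; rewrite inE connect0.
have /minW : closd (W :\: comp S x); last by lia.
apply/and3P; split; first by apply: subset_trans WS; apply: subsetDl.
  by lia.
apply/'forall_implyP => y; rewrite inE => /andP[yc yW].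
apply/'forall_implyP => z zS; apply/implyP=> yz; rewrite inE (clW _ _ yW) // andbT.
apply: contra yc; rewrite !inE => xz; apply: connect_trans xz _.
by apply: connect1; rewrite /within /= zS (subsetP WS) // e_sym.
Qed.

Lemma linked_unattached th K : linked th -> th <= #|K| ->
  #|[set x | ~~ attached K x]| < th.
Proof.
move=> lk cK; rewrite ltnNge; apply/negP => cA; have [x [y []]] := lk _ _ cA cK.
rewrite inE negb_exists => /forallP/(_ y) + yK exy.
by rewrite yK exy.
Qed.

(** The neighbours in [G] of [th] poor vertices number at most [th * g]. At least [th] vertices of
    [G] would then see none of these poor vertices, against linkedness. *)
Lemma linked_poor th g (G : {set V}) : linked th -> th * g + th <= #|G| ->
  #|[set x | #|nbh x :&: G| < g]| < th.
Proof.
move=> lk cG; rewrite ltnNge; apply/negP => cR.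
have [R sR cRth] := set_sized_subset cR.
pose N := \bigcup_(x in R) (nbh x :&: G).
have cN : #|N| <= th * g.
  rewrite -cRth; apply: leq_card_bigcup => x xR.
  by have := subsetP sR x xR; rewrite inE => /ltnW.
have cGN : th <= #|G :\: N|.
  have := cardsID N G; have := subset_leq_card (subsetIr G N); lia.
have [x [y [xR]]] := lk R _ (eq_leq (esym cRth)) cGN.
rewrite inE => /andP[/negP yN yG] xy; apply: yN.
by apply/bigcupP; exists x; rewrite // !inE xy.
Qed.

End Cores.

(** * Moves confined to a set of positions *)

Section Reach.
Variables (V : finType) (eX eY : rel V).
Hypotheses (eX_sym : symmetric eX) (eY_sym : symmetric eY).
Hypotheses (eX_irr : irreflexive eX) (eY_irr : irreflexive eY).
Implicit Types (s t : {perm V}) (U T P : {set V}).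
Local Open Scope group_scope.

(** An arrangement maps positions to people. In [tperm x y * s] the transposition acts first, so the
    occupants of the positions [x] and [y] are exchanged. *)
Definition step U : rel {perm V} := fun s t =>
  [exists x in U, exists y in U,
    [&& eX x y, eY (s x) (s y) & t == tperm x y * s]].

Definition reach U : rel {perm V} := connect (step U).

Lemma stepP U s t : reflect (exists x y, [/\ x \in U, y \in U, eX x y, eY (s x) (s y)
  & t = tperm x y * s]) (step U s t).
Proof.
apply: (iffP 'exists_andP) => [[x [xU /'exists_andP[y [yU /and3P[xy sxy /eqP ->]]]]]|].
  by exists x, y.
move=> [x [y [xU yU xy sxy ->]]]; exists x; split=> //.
by apply/'exists_andP; exists y; rewrite yU xy sxy eqxx.
Qed.

Lemma reachS U T s t : U \subset T -> reach U s t -> reach T s t.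
Proof.
move=> /subsetP sub; apply: connect_sub => {}s {}t /stepP[x [y [xU yU xy sxy tE]]].
by apply/connect1/stepP; exists x, y; rewrite !sub.
Qed.

Lemma reach_ind_inv U (P : {perm V} -> {perm V} -> Prop) :
  (forall s, P s s) ->
  (forall s t u, step U s t -> reach U t u -> P t u -> P s u) ->
  forall s t, reach U s t -> P s t.
Proof.
move=> P0 PS s t /connectP[p]; elim: p s => [|u p IH] s /= => [_ ->//|].
case/andP=> su pu tE; apply: (PS _ u) => //; last exact: IH.
by apply/connectP; exists p.
Qed.

Lemma reach_out U s t x : reach U s t -> x \notin U -> t x = s x.
Proof.
move=> r xU; move: s t r; apply: reach_ind_inv => // s t u /stepP[y [z [yU zU _ _ ->]]] _ ->.
by rewrite permM tpermD //; apply: contraNneq xU => <-.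
Qed.

Lemma reach_sym U : connect_sym (step U).
Proof.
apply: sym_connect_sym; have sub s t : step U s t -> step U t s.
  case/stepP=> [x [y [xU yU xy sxy ->]]]; apply/stepP; exists x, y; split=> //.
    by rewrite !permM tpermL tpermR eY_sym.
  by rewrite mulgA tperm2 mul1g.
by move=> s t; apply/idP/idP; apply: sub.
Qed.

Lemma reach_swap U s x y : x \in U -> y \in U -> eX x y -> eY (s x) (s y) ->
  reach U s (tperm x y * s).
Proof. by move=> *; apply/connect1/stepP; exists x, y. Qed.

(** The person starting at [x] swaps along the path. Whoever is displaced is again a friend of the
    walker, so all other occupants of [T] remain friends throughout. *)
Lemma walk T s x z : x \in T -> (forall y, y \in T -> y != x -> eY (s x) (s y)) ->
  connect (within eX T) x z -> exists2 t, reach T s t & t z = s x.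
Proof.
move=> xT fr /connectP[p]; elim: p s x xT fr => [|y p IH] s x xT fr /=.
  by move=> _ ->; exists s; rewrite // /reach connect0.
case/andP=> /and3P[_ yT xy] py lst.
have xNy : y != x by apply: contraTneq xy => ->; rewrite eX_irr.
have sxy := fr y yT xNy.
have [|t rt tz] := IH (tperm x y * s) y yT _ py lst.
  move=> w wT wNy; rewrite !permM tpermR.
  case: (eqVneq w x) => [->|wNx]; first by rewrite tpermL.
  by rewrite tpermD 1?eq_sym // fr.
exists t; last by rewrite tz permM tpermR.
by apply: connect_trans rt; apply: reach_swap.
Qed.

(** [walk] with the roles of the graphs exchanged: the position [c] stays put while its occupant
    changes along a path of friendships. Each swap takes place inside [P], so the set of people on
    [P] is invariant. *)
Lemma dual_walk P s c r : c \in P -> (forall x, x \in P -> x != c -> eX c x) ->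
  connect (within eY (s @: P)) (s c) r -> exists2 t, reach P s t & t c = r.
Proof.
move=> cP ad /connectP[p]; elim: p s => [|u p IH] s /=.
  by move=> _ ->; exists s; rewrite // /reach connect0.
case/andP=> /and3P[_ /imsetP[x xP ->] sxy] py lst.
have xNc : x != c by apply: contraTneq sxy => ->; rewrite eY_irr.
have sc : (tperm c x * s) c = s x by rewrite permM tpermL.
have sP : (tperm c x * s) @: P = s @: P.
  apply/eqP; rewrite eqEcard !card_imset ?leqnn ?andbT; try exact: perm_inj.
  apply/subsetP => _ /imsetP[y yP ->]; rewrite permM.
  by apply: imset_f; case: tpermP.
have [||t rt tz] := IH (tperm c x * s); [by rewrite sP sc py|by rewrite sc|].
exists t => //; apply: connect_trans rt; apply: reach_swap => //.
exact: ad.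
Qed.

(** Moves that avoid [a] and [b] are blind to who stands there, and their transpositions commute
    with [tperm a b]. *)
Lemma reach_conj U a b s t : a \notin U -> b \notin U -> reach U s t ->
  reach U (tperm a b * s) (tperm a b * t).
Proof.
move=> aU bU r; move: s t r; apply: reach_ind_inv => [s|s t u st _]; first exact: connect0.
apply: connect_trans; apply: connect1; move: st => /stepP[x [y [xU yU xy sxy ->]]].
apply/stepP; exists x, y.
have D w : w \in U -> tperm a b w = w.
  by move=> wU; rewrite tpermD //; apply: contraTneq wU => <-.
split=> //; first by rewrite !permM !D.
apply/permP => w; rewrite !permM.
have [wU|wU] := boolP (w \in U); last first.
  have wE : tperm x y w = w.
    by rewrite tpermD //; apply: contraNneq wU => <-.
  have abU : tperm a b w \notin U by case: tpermP => // _.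
  by rewrite wE [in LHS]tpermD //; apply: contraNneq abU => <-.
have xyU : tperm x y w \in U by case: tpermP.
by rewrite !D.
Qed.

End Reach.

(** * Colourings that split every set of a family evenly *)

Section Coloring.
Variables (V : finType) (k l : nat).
Implicit Types (S D : {set V}) (f : {ffun V -> 'I_k}).

Lemma card_color_missing D (c : 'I_k) :
  #|[set f : {ffun V -> 'I_k} | [forall x in D, f x != c]]| * k ^ #|D| = k.-1 ^ #|D| * k ^ #|V|.
Proof.
pose F x : pred 'I_k := if x \in D then predC1 c else predT.
have -> : #|[set f : {ffun V -> 'I_k} | [forall x in D, f x != c]]| = #|family F|.
  apply: eq_card => f; rewrite inE; apply/'forall_implyP/familyP => H x.
    by rewrite /F; case: ifP => // xD; rewrite inE; apply: H.
  by move=> xD; have := H x; rewrite /F xD inE.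
have -> : #|family F| = k.-1 ^ #|D| * k ^ #|~: D|.
  rewrite card_family foldrE big_map big_enum /=.
  rewrite (bigID (mem D)) /=; congr (_ * _).
    rewrite -prod_nat_const; apply: eq_bigr => x xD; rewrite /F xD.
    by rewrite cardC1 card_ord.
  rewrite -prod_nat_const; apply: eq_big => x; first by rewrite !inE.
  by rewrite /F => /negbTE ->; rewrite -[RHS]card_ord.
by rewrite -mulnA -expnD [#|~: D| + _]addnC cardsC.
Qed.

(** The [i]-th run of [l] consecutive elements in the enumeration of [S]; the last run may be
    shorter. *)
Definition block S i : {set V} := [set x in S | index x (enum S) %/ l == i].

Lemma card_block S i : i.+1 * l <= #|S| -> l <= #|block S i|.
Proof.
move=> le; have lt (j : 'I_l) : i * l + j < #|S|.
  by apply: leq_trans le; rewrite mulSn addnC ltn_add2r.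
pose h (j : 'I_l) := enum_val (Ordinal (lt j)).
have inj_h : injective h by move=> j1 j2 /enum_val_inj [/addnI /val_inj].
rewrite -{1}(card_ord l) -(card_imset _ inj_h); apply/subset_leq_card/subsetP.
move=> _ /imsetP[j _ ->]; rewrite inE enum_valP /=.
have l0 : 0 < l by apply: leq_ltn_trans (ltn_ord j).
rewrite /h /enum_val index_uniq ?enum_uniq ?cardE //=; last by rewrite -cardE lt.
by rewrite divnMDl // divn_small ?addn0.
Qed.

(* First moment bound over uniformly random colourings: every block of [l]
   vertices of every set of the family receives all colours. *)
Lemma balanced_coloring (F : {set {set V}}) : 0 < l ->
  k * (#|F| * #|V|) * k.-1 ^ l < k ^ l ->
  exists f : {ffun V -> 'I_k}, forall S m (c : 'I_k), S \in F -> l * m <= #|S| ->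
    m <= #|[set x in S | f x == c]|.
Proof.
move=> l0 small.
have [k0|k0] := posnP k; first by move: small; rewrite k0 exp0n.
(* The bad events: a colour is absent from a full block of a set of the family. Block indices stay
   below [#|V|], so there are at most [k * (#|F| * #|V|)] events. *)
pose I := [set t : 'I_k * ({set V} * 'I_#|V|) | (t.2.1 \in F) && (t.2.2.+1 * l <= #|t.2.1|)].
pose miss (t : 'I_k * ({set V} * 'I_#|V|)) :=
  [set f : {ffun V -> 'I_k} | [forall x in block t.2.1 t.2.2, f x != t.1]].
have missc t : t \in I -> #|miss t| * k ^ l <= k.-1 ^ l * k ^ #|V|.
  rewrite inE => /andP[_ /card_block cb].
  rewrite -(@leq_pmul2r (k ^ (#|block t.2.1 t.2.2| - l))) ?expn_gt0 ?k0 //.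
  rewrite -[_ * _ * _]mulnA -expnD subnKC // card_color_missing.
  rewrite -{1}(subnKC cb) expnD mulnAC leq_mul2l; apply/orP; right.
  by have [->|bl] := posnP (#|block t.2.1 t.2.2| - l); rewrite // leq_exp2r // leq_pred.
have [f fP] : exists f, f \notin \bigcup_(t in I) miss t.
  apply/existsP; rewrite -negb_forall; apply/negP => /forallP all_bad.
  suff : #|\bigcup_(t in I) miss t| * k ^ l < k ^ #|V| * k ^ l.
    have -> : \bigcup_(t in I) miss t = setT by apply/setP => f; rewrite all_bad inE.
    by rewrite cardsT card_ffun card_ord ltnn.
  apply: (@leq_ltn_trans (\sum_(t in I) k.-1 ^ l * k ^ #|V|)).
    apply: (@leq_trans ((\sum_(t in I) #|miss t|) * k ^ l)).
      rewrite leq_mul2r; apply/orP; right.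
      by apply: (big_ind2 (fun (A : {set _}) m => #|A| <= m)) => //; rewrite ?cards0 // => A m B p Am Bp;
        rewrite (leq_trans (leq_card_setU A B)) ?leq_add.
    by rewrite big_distrl /=; apply: leq_sum => t tI; apply: missc.
  rewrite sum_nat_const mulnA [k ^ #|V| * _]mulnC ltn_pmul2r ?expn_gt0 ?k0 //.
  apply: leq_ltn_trans small; rewrite leq_mul2r; apply/orP; right.
  apply: (@leq_trans #|setX [set: 'I_k] (setX F [set: 'I_#|V|])|).
    by apply/subset_leq_card/subsetP => t; rewrite !inE /= => /andP[-> _].
  by rewrite !cardsX !cardsT !card_ord.
exists f => S m c SF le.
have mV : m <= #|V| by apply: leq_trans (leq_pmull m l0) (leq_trans le (max_card _)).
(* Each of the first [m] blocks supplies a vertex of colour [c]; the block index recovers [i], so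
   these vertices are distinct. *)
have blk (i : 'I_m) : exists x, (x \in block S i) && (f x == c).
  have iV : i < #|V| by apply: leq_trans mV.
  move: fP => /bigcupP fP; apply/existsP; apply: contraT; rewrite negb_exists => /forallP no.
  case: fP; exists (c, (S, Ordinal iV)); rewrite !inE /= ?SF /=.
    by apply: leq_trans le; rewrite mulnC leq_mul2l ltn_ord orbT.
  by apply/'forall_implyP => x xb; have := no x; rewrite xb.
pose h i := xchoose (blk i).
have hE (i : 'I_m) : index (h i) (enum S) %/ l = i.
  by have /andP[] := xchooseP (blk i); rewrite inE => /andP[_ /eqP].
have inj_h : injective h by move=> i j hij; apply/val_inj; rewrite /= -hE hij hE.
rewrite -{1}(card_ord m) -(card_imset _ inj_h); apply/subset_leq_card/subsetP.
move=> _ /imsetP[i _ ->]; have /andP[] := xchooseP (blk i); rewrite -/(h i) !inE.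
by case/andP=> -> _ ->.
Qed.

End Coloring.

Lemma pick_avoiding (V : finType) th (A : {set V}) (Bs : seq {set V}) :
  0 < #|A| -> size Bs * th <= #|A| -> all (fun B : {set V} => #|B| < th) Bs ->
  exists2 x, x \in A & all (fun B : {set V} => x \notin B) Bs.
Proof.
move=> A0 cA small.
have bound : #|\bigcup_(B <- Bs) B| <= size Bs * th.-1.
  elim: Bs small {cA} => [|B Bs IH] /=; first by rewrite big_nil cards0.
  case/andP=> Bth /IH; rewrite big_cons mulSn => le.
  by apply: leq_trans (leq_card_setU _ _) _; apply: leq_add => //; rewrite -ltnS prednK //; lia.
have lt : #|\bigcup_(B <- Bs) B| < #|A|.
  case: Bs cA small bound => [|B Bs]; first by rewrite big_nil cards0.
  move=> cA /andP[Bth _] le; apply: leq_ltn_trans le _; apply: leq_trans cA.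
  by rewrite ltn_pmul2l //; lia.
have [x xA] : exists x, x \in A :\: \bigcup_(B <- Bs) B.
  apply/card_gt0P; have := cardsID (\bigcup_(B <- Bs) B) A.
  have := subset_leq_card (subsetIr A (\bigcup_(B <- Bs) B)); lia.
move: xA; rewrite inE => /andP[xB xA]; exists x => //.
rewrite all_predC; apply: contra xB; elim: Bs {small bound lt cA} => [|B Bs IH] //=.
by rewrite big_cons inE => /orP[->//|/IH ->]; rewrite orbT.
Qed.

(** * Transporting people *)

(* The positions held by the friends of the person [r] in the arrangement [s]. *)
Definition friends (V : finType) (eY : rel V) (s : {perm V}) (r : V) : {set V} :=
  [set x | eY r (s x)].

(** The deterministic outcome of the union bound over all arrangements. Each [z] comes with its own
    person [r z]; hence fewer than [q] positions outside [W] can fail, each for some person of its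
    own. Disjointness of [Z] and [W] separates the edges tested from those that determine the
    cores. *)
Definition spread (V : finType) (eX eY : rel V) (th q ka : nat) :=
  forall (s : {perm V}) (W Z : {set V}) (r : V -> V),
    q <= #|Z| -> [disjoint Z & W] ->
    (forall z, z \in Z -> ka <= #|core eX th (friends eY s (r z) :&: W)|) ->
    exists2 z, z \in Z & attached eX (core eX th (friends eY s (r z) :&: W)) z.

Lemma leq_card_setD (V : finType) (A B : {set V}) a b :
  #|B| <= b -> a + b <= #|A| -> a <= #|A :\: B|.
Proof.
have := cardsID B A; have := subset_leq_card (subsetIr A B); lia.
Qed.

Section Relay.
Variables (V : finType) (eX eY : rel V).
Hypotheses (eX_sym : symmetric eX) (eY_sym : symmetric eY).
Hypotheses (eX_irr : irreflexive eX) (eY_irr : irreflexive eY).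
Variables (th q l g m m' : nat).
Hypotheses (lkX : linked eX th) (lkY : linked eY th).
Hypothesis (spr : spread eX eY th q (m - th)).
Hypotheses (th_gt0 : 0 < th) (l_gt0 : 0 < l).
Hypothesis colors : 10 * ((#|V| + 3) * #|V|) * 9 ^ l < 10 ^ l.
Hypotheses (le_g : l * m <= g) (le_m : 3 * th <= m).
Hypothesis (le_m' : th * (3 * th) + th + 3 * q <= m').
Implicit Types (s t : {perm V}) (U A B : {set V}).

(** The person [r] steps from [a] into the core, crosses it since it is connected, and steps out to
    [b]. *)
Lemma walk_via s r (K : {set V}) a b :
  K \subset friends eY s r -> s a = r -> b \in friends eY s r ->
  attached eX (core eX th K) a -> attached eX (core eX th K) b ->
  exists2 t, reach eX eY (a |: (b |: K)) s t & t b = r.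
Proof.
move=> /subsetP KF sa bF /'exists_andP[x [xK ax]] /'exists_andP[y [yK bY]].
have KT : K \subset a |: (b |: K) by apply/subsetP => z zK; rewrite !inE zK !orbT.
have xT : x \in a |: (b |: K) by apply: (subsetP KT); apply: (subsetP (coreS eX th K)).
have yT : y \in a |: (b |: K) by apply: (subsetP KT); apply: (subsetP (coreS eX th K)).
rewrite -sa; apply: walk => //; first by rewrite setU11.
  move=> z; rewrite !inE => /or3P[/eqP->|/eqP->|zK]; rewrite ?eqxx // => _.
    by move: bF; rewrite inE sa.
  by have := KF z zK; rewrite inE sa.
apply: (@connect_trans _ _ x).
  by apply: connect1; rewrite /within /= setU11 xT.
apply: (@connect_trans _ _ y).
  by apply: within_connectS (core_connect eX_sym lkX xK yK).
by apply: connect1; rewrite /within /= yT !inE eqxx orbT eX_sym.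
Qed.

(** The three walks use differently coloured positions, so the later ones still find the original
    occupants along their way. *)
Lemma relay s U A B :
  l * m' <= #|U| -> th * g + th <= #|U| -> A \subset U -> B \subset s @: U ->
  l * (5 * th) <= #|A| -> l * (5 * th) <= #|B| ->
  exists r z t, [/\ r \in B, z \in A, reach eX eY U s t & t z = r].
Proof.
move=> cU cU' AU BU cA cB.
pose F r := friends eY s r :&: U.
pose rich := [set r | g <= #|F r|].
have F_nbh r : #|F r| = #|nbh eY r :&: s @: U|.
  rewrite -(card_imset _ (@perm_inj _ s)); apply: eq_card => x.
  rewrite !inE; apply/imsetP/andP => [[y + ->]|[rx /imsetP[y yU xE]]].
    by rewrite !inE => /andP[ry yU]; rewrite ry imset_f.
  by exists y; rewrite ?inE -?xE ?rx.
have poor_small : #|~: rich| < th.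
  have := @linked_poor _ eY th g (s @: U) lkY; rewrite card_imset; last exact: perm_inj.
  move=> /(_ cU'); congr (_ < _); apply: eq_card => x; rewrite !inE -F_nbh.
  by rewrite -ltnNge.
(* The sets whose colour classes must be large: the friends of rich people within [U], then [A], the
   positions of [B], and [U]. They number at most [#|V| + 3], as in the hypothesis [colors]. *)
pose fam : {set {set V}} := [set F r | r in rich] :|: [set A; s @^-1: B; U].
have [f fP] : exists f : {ffun V -> 'I_10}, forall S m0 (c : 'I_10), S \in fam ->
    l * m0 <= #|S| -> m0 <= #|[set x in S | f x == c]|.
  apply: balanced_coloring => //; apply: leq_ltn_trans colors.
  rewrite leq_mul2r leq_mul2l leq_mul2r; do 3![apply/orP; right].
  apply: leq_trans (leq_card_setU _ _) _; apply: leq_add.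
    by apply: leq_trans (leq_imset_card _ _) (max_card _).
  by rewrite -setUA; apply: leq_trans (leq_card_setU _ _) _; rewrite cards1 cards2; case: (_ == _).
(* The colours 7, 8, 9 are reserved for three walks, and the colours 0 to 6 for their
   end points: the target [z], the place [x] of [r], and then [h], [gt], [h1], [gw],
   [h2].  First [t = s gt] walks to [h] and steps to [z]; next [w = s gw] walks to [h1]
   and changes places with [r]; finally [r] walks from [h1] to [h2] and changes places
   with [t] at [z]. *)
pose col (c : nat) : 'I_10 := inord c.
have colE c x : c < 10 -> (f x == col c) = (f x == c :> nat).
  by move=> c10; rewrite -val_eqE /= inordK.
pose Uc c := [set x in U | f x == c :> nat].
pose K r c := core eX th (friends eY s r :&: Uc c).
have FUc r c : friends eY s r :&: Uc c = [set x in F r | f x == c :> nat].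
  by apply/setP => x; rewrite !inE andbA.
have FUc_card r c : r \in rich -> c < 10 -> m <= #|friends eY s r :&: Uc c|.
  move=> rr c10; rewrite FUc; have := fP (F r) m (col c); rewrite inE imset_f // => /(_ isT).
  move: rr; rewrite inE => rr /(_ (leq_trans le_g rr)); congr (_ <= _).
  by apply: eq_card => x; rewrite !inE colE.
have K_card r c : r \in rich -> c < 10 -> m - th <= #|K r c|.
  move=> rr c10; have mF := FUc_card _ _ rr c10; rewrite leq_subLR addnC.
  exact: (leq_trans mF (core_card eX_sym lkX (leq_trans le_m mF))).
pose bad c j := [set x in Uc j | [exists r in rich, ~~ attached eX (K r c) x]].
have bad_small (c j : nat) : c < 10 -> j != c -> #|bad c j| < q.
  move=> c10 jc; rewrite ltnNge; apply/negP => cb.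
  (* For a bad position, a rich person whose core is missed; the default [x] is never taken on
     [bad c j]. This choice is the map [r] in [spread]. *)
  pose rr x := odflt x [pick r in rich | ~~ attached eX (K r c) x].
  have rrP x : x \in bad c j -> (rr x \in rich) && ~~ attached eX (K (rr x) c) x.
    rewrite inE /rr => /andP[_ /'exists_andP[r [rR ra]]]; case: pickP => // /(_ r).
    by rewrite rR ra.
  have [||x xb] := @spr s (Uc c) (bad c j) rr cb.
  - rewrite -setI_eq0; apply/eqP/setP => x; rewrite !inE.
    apply/negP => /andP[/andP[/andP[_ /eqP fj] _] /andP[_ /eqP fc]].
    by move: jc; rewrite -fj fc eqxx.
  - by move=> x /rrP/andP[rR _]; apply: K_card.
  by apply/negP; case/andP: (rrP _ xb).
(* Positions of colour [j] attached, in all three walking regions, to the cores of all rich people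
   at once. *)
pose good j := Uc j :\: (bad 7 j :|: bad 8 j :|: bad 9 j).
have goodP j x r (c : nat) : x \in good j -> r \in rich -> [|| c == 7, c == 8 | c == 9] ->
    attached eX (K r c) x.
  case/setDP=> xj xb rR cin; apply: contraT => nat.
  have xbad : x \in bad c j.
    by rewrite inE xj; apply/existsP; exists r; rewrite rR.
  case/or3P: cin => /eqP cE; rewrite cE in xbad; case/negP: xb; apply/setUP.
  - by left; apply/setUP; left.
  - by left; apply/setUP; right.
  - by right.
have good_card j : j < 7 -> th * (3 * th) + th <= #|good j|.
  move=> j7; have j10 : j < 10 by lia.
  have UF : U \in fam by rewrite !inE eqxx !orbT.
  have := fP U m' (col j) UF cU.
  have -> : [set x in U | f x == col j] = Uc j by apply/setP => x; rewrite !inE colE.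
  have := bad_small 7 j isT; have := bad_small 8 j isT; have := bad_small 9 j isT.
  have -> : j != 7 by lia.
  have -> : j != 8 by lia.
  have -> : j != 9 by lia.
  move=> /(_ isT) b9 /(_ isT) b8 /(_ isT) b7.
  rewrite /good; have := cardsID (bad 7 j :|: bad 8 j :|: bad 9 j) (Uc j).
  have := subset_leq_card (subsetIr (Uc j) (bad 7 j :|: bad 8 j :|: bad 9 j)).
  have [+ _] := leq_card_setU (bad 7 j :|: bad 8 j) (bad 9 j).
  have [+ _] := leq_card_setU (bad 7 j) (bad 8 j); lia.
have poorX j : j < 7 -> #|[set x | #|nbh eX x :&: good j| < 3 * th]| < th.
  by move=> j7; apply: linked_poor => //; apply: good_card.
have poorY j : j < 7 -> #|[set x | #|nbh eY x :&: s @: good j| < 3 * th]| < th.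
  move=> j7; apply: linked_poor => //; rewrite card_imset; [exact: good_card|exact: perm_inj].
have colU j x : x \in good j -> x \in Uc j by rewrite inE => /andP[].
pose A0 := [set x in A | f x == 0 :> nat].
have cA0 : 5 * th <= #|A0|.
  have := fP A (5 * th)%N (col 0); rewrite !inE eqxx !orbT => /(_ isT cA).
  by congr (_ <= _); apply: eq_card => x; rewrite !inE colE.
have sP (S : {set V}) : #|s @^-1: S| = #|S|.
  by rewrite -im_permV card_imset //; exact: perm_inj.
pose B0 := [set x in s @^-1: B | f x == 1 :> nat].
have cB0 : 5 * th <= #|B0|.
  have := fP (s @^-1: B) (5 * th)%N (col 1); rewrite !inE eqxx !orbT sP => /(_ isT cB).
  by congr (_ <= _); apply: eq_card => x; rewrite !inE colE.
have card_s (S : {set V}) : #|s @: S| = #|S| by rewrite card_imset //; exact: perm_inj.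
have linked_miss (S : {set V}) : th <= #|S| ->
    #|[set x | ~~ [exists y in S, eY x y]]| < th by apply: linked_unattached.
(* The target [z] needs neighbours in the good colours 2 and 6, and its occupant needs friends in
   the good colour 3. Each demand fails at fewer than [th] positions. *)
have [|||] := @pick_avoiding _ th A0 [:: [set x | #|nbh eX x :&: good 2| < 3 * th];
    [set x | #|nbh eX x :&: good 6| < 3 * th];
    s @^-1: [set x | #|nbh eY x :&: s @: good 3| < 3 * th]].
- by lia.
- by move=> /=; lia.
- by rewrite /= sP !poorX ?poorY.
move=> z; rewrite inE => /andP[zA fz]; rewrite /= !inE -!leqNgt andbT => /and3P[zh zh2 zt].
pose H := nbh eX z :&: good 2.
(* Candidates for [t]. Being rich and having a friend on [H] each exclude fewer than [th] of the
   [3 * th] friends of the occupant of [z]. *)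
pose T := [set t in nbh eY (s z) :&: s @: good 3 | (t \in rich) && [exists y in s @: H, eY t y]].
have cT : th <= #|T|.
  have missH := linked_miss (s @: H); rewrite card_s in missH.
  have {}missH := missH (leq_trans (leq_pmull th (isT : 0 < 3)) zh).
  have : nbh eY (s z) :&: s @: good 3 \subset
      T :|: (~: rich :|: [set x | ~~ [exists y in s @: H, eY x y]]).
    apply/subsetP => x xN; rewrite inE [x \in T]inE xN /= !inE.
    by case: (_ <= _); case: [exists _ in _, _].
  move/subset_leq_card; have [+ _] := leq_card_setU T (~: rich :|: [set x | ~~ [exists y in s @: H, eY x y]]).
  have [+ _] := leq_card_setU (~: rich) [set x | ~~ [exists y in s @: H, eY x y]].
  lia.
pose H2 := nbh eX z :&: good 6.
(* Five demands on the place [x] of [r], hence [5 * th]: [r] has a friend in [T] and one on [H2],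
   [x] has neighbours in the good colour 4, [r] has friends in the good colour 5, and [r] is
   rich. *)
have [|||] := @pick_avoiding _ th B0 [:: s @^-1: [set x | ~~ [exists y in T, eY x y]];
   s @^-1: [set x | ~~ [exists y in s @: H2, eY x y]];
   [set x | #|nbh eX x :&: good 4| < 3 * th];
   s @^-1: [set x | #|nbh eY x :&: s @: good 5| < 3 * th]; s @^-1: (~: rich)].
- by lia.
- by move=> /=; lia.
- rewrite /= !sP poorX ?poorY ?linked_miss ?card_s ?poor_small //=.
  exact: leq_trans (leq_pmull th (isT : 0 < 3)) zh2.
move=> x; rewrite inE => /andP[xB fx]; rewrite /= !inE -!leqNgt !negbK andbT.
case/and5P=> /'exists_andP[t [tT rt]] /'exists_andP[_ [/imsetP[h2 h2H ->] rh2]] xh1 xs rR.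
pose r := s x; rewrite -/r in rt rh2 xs rR; have {}xB : r \in B by move: xB; rewrite inE.
have {}rR : r \in rich by rewrite inE.
move: tT; rewrite inE => /andP[/setIP[zt0 /imsetP[gt gtG tE]] /andP[tR]].
rewrite inE in zt0.
case/'exists_andP=> _ [/imsetP[h hH ->] th0].
(* Candidates for [w]; linkedness of [eY] then provides one with a friend at a good neighbour [h1]
   of [x], where the walk of [w] can end. *)
pose Sw := (nbh eY r :&: s @: good 5) :\: ~: rich.
have cSw : th <= #|Sw|.
  apply: leq_card_setD (ltnW poor_small) _; apply: leq_trans xs.
  by rewrite addnn -muln2 mulnC leq_mul2r orbT.
have [w [_ [wS /imsetP[h1 h1H ->] wh1]]] :
    exists w y, [/\ w \in Sw, y \in s @: (nbh eX x :&: good 4) & eY w y].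
  apply: lkY; first exact: cSw.
  rewrite card_s; exact: leq_trans (leq_pmull th (isT : 0 < 3)) xh1.
have [rw wG wR] : [/\ eY r w, w \in s @: good 5 & w \in rich].
  by case/setDP: wS => /setIP[rw wG]; rewrite inE negbK => wR; split=> //; move: rw; rewrite inE.
case/imsetP: wG => gw gwG wE.
have Uc_of c y : y \in Uc c -> y \in U /\ f y = c :> nat.
  by rewrite inE => /andP[-> /eqP].
have [hz hG] : eX z h /\ h \in good 2 by case/setIP: hH; rewrite [h \in nbh _ _]inE.
have [h2z h2G] : eX z h2 /\ h2 \in good 6 by case/setIP: h2H; rewrite [h2 \in nbh _ _]inE.
have [xh h1G] : eX x h1 /\ h1 \in good 4 by case/setIP: h1H; rewrite [h1 \in nbh _ _]inE.

have [gtU fgt] := Uc_of _ _ (colU _ _ gtG); have [hU fh] := Uc_of _ _ (colU _ _ hG).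
have [gwU fgw] := Uc_of _ _ (colU _ _ gwG); have [h1U fh1] := Uc_of _ _ (colU _ _ h1G).
have [h2U fh2] := Uc_of _ _ (colU _ _ h2G).
have zU : z \in U by apply: (subsetP AU).
have xU : x \in U by have /imsetP[y yU /perm_inj ->] := subsetP BU _ xB.
have {}fz : f z = 0 :> nat by apply/eqP.
have {}fx : f x = 1 :> nat by apply/eqP.
pose W v c := friends eY s v :&: Uc c.
have W_of v c y : y \in W v c -> [/\ eY v (s y), y \in U & f y = c :> nat].
  by rewrite !inE => /and3P[-> -> /eqP].
have ne (y y' : V) c c' : f y = c :> nat -> f y' = c' :> nat -> c != c' -> y != y'.
  by move=> fy fy'; apply: contraNneq => yy'; rewrite -fy -fy' yy'.
have [s1 rs1 s1h] : exists2 s1, reach eX eY (gt |: (h |: W t 7)) s s1 & s1 h = t.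
  apply: walk_via; [exact: subsetIl|by rewrite tE|by rewrite inE| |].
    exact: (goodP _ _ _ 7 gtG tR isT).
  exact: (goodP _ _ _ 7 hG tR isT).
have out v a b c ca cb (y : V) : f a = ca :> nat -> f b = cb :> nat ->
    (f y : nat) \notin [:: ca; cb; c] -> y \notin a |: (b |: W v c).
  move=> fa fb; rewrite !inE !negb_or => /and3P[ya yb yc].
  rewrite (ne _ _ _ _ (erefl _) fa) // (ne _ _ _ _ (erefl _) fb) //=.
  by apply: contra yc => /and3P[].
have s1E y : (f y : nat) \notin [:: 3; 2; 7] -> s1 y = s y.
  by move=> fy; apply: reach_out rs1 _; apply: out fy.
pose s2 := (tperm h z * s1)%g.
have rs2 : reach eX eY U s1 s2.
  by apply: reach_swap; rewrite // ?[eX h z]eX_sym // s1h s1E ?fz // eY_sym.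
have s2z : s2 z = t by rewrite permM tpermR.
have s2E y : (f y : nat) \notin [:: 0; 2; 3; 7] -> s2 y = s y.
  rewrite !inE !negb_or => /and4P[y0 y2 y3 y7]; rewrite permM tpermD.
  - by rewrite s1E // !inE !negb_or y3 y2.
  - by rewrite eq_sym (ne _ _ _ _ (erefl _) fh).
  - by rewrite eq_sym (ne _ _ _ _ (erefl _) fz).
have [s3 rs3 s3h] : exists2 s3, reach eX eY (gw |: (h1 |: W w 8)) s2 s3 & s3 h1 = w.
  apply: walk_via.
  - by apply/subsetP => y /W_of[wy _ fy]; rewrite inE s2E // fy.
  - by rewrite s2E ?fgw.
  - by rewrite inE s2E ?fh1.
  - exact: (goodP _ _ _ 8 gwG wR isT).
  - exact: (goodP _ _ _ 8 h1G wR isT).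
have s3E y : (f y : nat) \notin [:: 5; 4; 8] -> s3 y = s2 y.
  by move=> fy; apply: reach_out rs3 _; apply: out fy.
pose s4 := (tperm h1 x * s3)%g.
have rs4 : reach eX eY U s3 s4.
  by apply: reach_swap; rewrite // ?[eX h1 x]eX_sym // s3h s3E ?fx // s2E ?fx // eY_sym.
have s4h1 : s4 h1 = r by rewrite permM tpermL s3E ?fx // s2E ?fx.
have s4E y : (f y : nat) \notin [:: 1; 4; 5; 8] -> s4 y = s2 y.
  rewrite !inE !negb_or => /and4P[y1 y4 y5 y8]; rewrite permM tpermD.
  - by rewrite s3E // !inE !negb_or y5 y4.
  - by rewrite eq_sym (ne _ _ _ _ (erefl _) fh1).
  - by rewrite eq_sym (ne _ _ _ _ (erefl _) fx).
have [s5 rs5 s5h] : exists2 s5, reach eX eY (h1 |: (h2 |: W r 9)) s4 s5 & s5 h2 = r.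
  apply: walk_via.
  - by apply/subsetP => y /W_of[wy _ fy]; rewrite inE s4E ?s2E // fy.
  - exact: s4h1.
  - by rewrite inE s4E ?s2E ?fh2.
  - exact: (goodP _ _ _ 9 h1G rR isT).
  - exact: (goodP _ _ _ 9 h2G rR isT).
have s5z : s5 z = t.
  by rewrite -s2z -s4E ?fz //; apply: reach_out rs5 _; apply: out fh1 fh2 _; rewrite fz.
exists r, z, (tperm h2 z * s5)%g; split=> //; last by rewrite permM tpermR.
have WU v c a b : a \in U -> b \in U -> a |: (b |: W v c) \subset U.
  by move=> aU bU; apply/subsetP => y; rewrite !inE => /or3P[/eqP->|/eqP->|/and3P[]].
apply: connect_trans (reachS (WU _ _ _ _ gtU hU) rs1) _; apply: connect_trans rs2 _.
apply: connect_trans (reachS (WU _ _ _ _ gwU h1U) rs3) _; apply: connect_trans rs4 _.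
apply: connect_trans (reachS (WU _ _ _ _ h1U h2U) rs5) _.
by apply: reach_swap; rewrite // ?[eX h2 z]eX_sym // s5h s5z.
Qed.

End Relay.

Section Transport.
Variables (V : finType) (eX eY : rel V).
Hypotheses (eX_sym : symmetric eX) (eY_sym : symmetric eY).
Hypotheses (eX_irr : irreflexive eX) (eY_irr : irreflexive eY).
Variables (th d a0 : nat).
Hypotheses (lkX : linked eX th) (lkY : linked eY th).
Hypotheses (degX : forall x, d <= #|nbh eX x|) (degY : forall x, d <= #|nbh eY x|).
Hypothesis relays : forall (s : {perm V}) (U A B : {set V}),
  #|~: U| <= 6 * th + 8 -> A \subset U -> B \subset s @: U ->
  a0 <= #|A| -> a0 <= #|B| ->
  exists r z t, [/\ r \in B, z \in A, reach eX eY U s t & t z = r].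
Hypothesis le_d : a0 + 7 * th + 8 <= d.
Implicit Types (s t : {perm V}) (U A B S : {set V}).

Lemma card_friends s r : #|friends eY s r| = #|nbh eY r|.
Proof.
rewrite -(card_imset _ (@perm_inj _ s)); apply: eq_card => x; rewrite inE.
apply/imsetP/idP => [[y + ->]|rx]; first by rewrite inE.
by exists (s^-1 x)%g; rewrite ?inE permKV.
Qed.

Lemma card_trim S A U k u : d <= #|S| -> #|~: A| <= k -> #|~: U| <= u ->
  a0 + k + u <= d -> a0 <= #|S :&: A :&: U|.
Proof.
move=> dS cA cU le.
have : S \subset (S :&: A :&: U) :|: (~: A :|: ~: U).
  by apply/subsetP => x; rewrite !inE => ->; case: (x \in A); case: (x \in U).
move/subset_leq_card; have [+ _] := leq_card_setU (S :&: A :&: U) (~: A :|: ~: U).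
have [+ _] := leq_card_setU (~: A) (~: U); lia.
Qed.

(** A relay between the friends of [v] in [A'] and the neighbours of [x] in [A]. The degree [d]
    leaves [a0] of each after discarding [th] exceptions and [6 * th + 7] protected positions. *)
Lemma relay_near s (P : {set V}) x v (A A' : {set V}) : #|P| <= 6 * th + 7 ->
  #|~: A| <= th -> #|~: A'| <= th ->
  exists r z t, [/\ reach eX eY (~: P) s t, t z = r, eX x z, eY v r
    & [/\ z \in A, r \in A' & z \notin P]].
Proof.
move=> cP cA cA'.
have [|||||r [z [t [rB zA rt tz]]]] := @relays s (~: P) (nbh eX x :&: A :&: ~: P)
    (s @: (friends eY s v :&: (s @^-1: A') :&: ~: P)).
- by rewrite setCK; lia.
- exact: subsetIr.
- by apply: imsetS; apply: subsetIr.
- by apply: (@card_trim _ _ _ th (6 * th + 7)); rewrite ?degX ?setCK //; lia.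
- rewrite card_imset; last exact: perm_inj.
  apply: (@card_trim _ _ _ th (6 * th + 7)); rewrite ?card_friends ?degY ?setCK //; last by lia.
  by rewrite -preimsetC -im_permV card_imset //; exact: perm_inj.
exists r, z, t; move: zA; rewrite !inE => /andP[/andP[-> ->] ->].
by case/imsetP: rB => y + rE; rewrite !inE -rE => /andP[/andP[-> ->] _].
Qed.

Lemma core_unattached (e : rel V) S : symmetric e -> linked e th -> #|S| = 3 * th ->
  #|~: [set x | attached e (core e th S) x]| <= th.
Proof.
move=> e_sym lk cS; have -> : ~: [set x | attached e (core e th S) x] =
  [set x | ~~ attached e (core e th S) x] by apply/setP => x; rewrite !inE.
apply/ltnW/linked_unattached => //.
by have := core_card e_sym lk (eq_leq (esym cS)); rewrite cS; lia.
Qed.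

Lemma subset_setD_sized (A B : {set V}) k : k + #|B| <= #|A| ->
  exists2 S : {set V}, S \subset A :\: B & #|S| = k.
Proof. by move=> le; apply: set_sized_subset; apply: leq_card_setD le. Qed.

(** Relays choose whom they move, so [w] itself cannot be relayed. Instead friends of [w] are
    brought to where [w] must pass, and then [w] walks. *)
Lemma transport s w c a b :
  a != c -> b != c -> s a != w -> s b != w ->
  exists2 t, reach eX eY (~: [set a; b]) s t & t c = w.
Proof.
move=> ac bc sa sb.
pose x0 := (s^-1 w)%g; have sx0 : s x0 = w by rewrite permKV.
have [x0c|x0c] := eqVneq x0 c; first by exists s; rewrite ?x0c -?sx0 ?x0c //; exact: connect0.
have ax0 : a != x0 by apply: contraNneq sa => ->; rewrite sx0.
have bx0 : b != x0 by apply: contraNneq sb => ->; rewrite sx0.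
(* The relays below leave [S1] and [N1] untouched: in the end the occupant of [c] is
   changed from [r4] to [r3] through the core of the people on [N1], and [w] goes from
   [x0] to [z1], through the core of [S1] to [z2], and then to [c]. *)
pose F0 := [set a; b; c; x0].
have cF0 : #|F0| <= 4.
  by rewrite /F0 -!setUA !cardsU1 cards1; do 3![case: (_ \notin _)].
have [S1 S1w cS1] : exists2 S1 : {set V}, S1 \subset friends eY s w :\: F0 & #|S1| = 3 * th.
  by apply: subset_setD_sized; have := degY w; rewrite card_friends; lia.
have cFS : #|F0 :|: S1| <= 3 * th + 4.
  by rewrite addnC -cS1; apply: leq_trans (leq_card_setU _ _) _; rewrite leq_add2r.
have [N1 N1c cN1] : exists2 N1 : {set V}, N1 \subset nbh eX c :\: (F0 :|: S1) & #|N1| = 3 * th.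
  by apply: subset_setD_sized; have := degX c; lia.
pose K := core eX th S1; pose K' := core eY th (s @: N1).
pose att := [set x | attached eX K x]; pose att' := [set x | attached eY K' x].
have catt : #|~: att| <= th by apply: core_unattached.
have catt' : #|~: att'| <= th.
  by apply: core_unattached => //; rewrite card_imset //; exact: perm_inj.
pose P0 := F0 :|: S1 :|: N1.
have cP0 : #|P0| <= 6 * th + 4.
  by have [+ _] := leq_card_setU (F0 :|: S1) N1; rewrite -/P0 cN1; lia.
have noC : #|~: [set: V]| <= th by rewrite setCT cards0.
(* Each relay freezes one more position for the following ones, so the protected set grows from
   [6 * th + 4] to [6 * th + 7]. *)
have cP z (P : {set V}) k : #|P| <= 6 * th + k -> #|z |: P| <= 6 * th + k.+1.
  by rewrite cardsU1 addnS -add1n; apply: leq_add (leq_b1 _).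
have cP1 z := cP z _ _ cP0; have cP2 z z' := cP z _ _ (cP1 z').
have cP3 z z' z'' := cP z _ _ (cP2 z' z'').
have le7 k : k <= 7 -> 6 * th + k <= 6 * th + 7 by rewrite leq_add2l.
(* [r1] at [z1] lets [w] leave [x0], and [r2] at [z2] lets [w] arrive next to [c]. [r3] is the
   friend of [w] destined for [c]; [r4], a friend of the occupant of [c], opens the dual walk that
   puts [r3] there. *)
have [r1 [z1 [s1 [rs1 s1z e1 f1 [z1A _ z1P]]]]] :=
  relay_near s x0 w (leq_trans cP0 (le7 4 isT)) catt noC.
have [r2 [z2 [s2 [rs2 s2z e2 f2 [z2A _ z2P]]]]] :=
  relay_near s1 c w (leq_trans (cP1 z1) (le7 5 isT)) catt noC.
have [r3 [z3 [s3 [rs3 s3z e3 f3 [_ r3A z3P]]]]] :=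
  relay_near s2 c w (leq_trans (cP2 z2 z1) (le7 6 isT)) noC catt'.
have [r4 [z4 [s4 [rs4 s4z e4 f4 [_ r4A z4P]]]]] :=
  relay_near s3 c (s c) (leq_trans (cP3 z3 z2 z1) (le7 7 isT)) noC catt'.
have outP (s' t' : {perm V}) (P : {set V}) x : reach eX eY (~: P) s' t' -> x \in P -> t' x = s' x.
  by move=> rst xP; apply: reach_out rst _; rewrite inE negbK.
have sub1 x : x \in P0 -> x \in z1 |: P0 by move=> xP; rewrite inE xP orbT.
have sub2 x : x \in z1 |: P0 -> x \in z2 |: (z1 |: P0) by move=> xP; rewrite inE xP orbT.
have sub3 x : x \in z2 |: (z1 |: P0) -> x \in z3 |: (z2 |: (z1 |: P0)).
  by move=> xP; rewrite inE xP orbT.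
have s4E x : x \in P0 -> s4 x = s x.
  move=> xP; rewrite (outP _ _ _ _ rs4) ?sub3 ?sub2 ?sub1 //.
  rewrite (outP _ _ _ _ rs3) ?sub2 ?sub1 // (outP _ _ _ _ rs2) ?sub1 //.
  exact: outP rs1 xP.
have z1in : z1 \in z1 |: P0 by rewrite setU11.
have s4z1 : s4 z1 = r1.
  by rewrite (outP _ _ _ _ rs4) ?sub3 ?sub2 // (outP _ _ _ _ rs3) ?sub2 // (outP _ _ _ _ rs2).
have s4z2 : s4 z2 = r2.
  by rewrite (outP _ _ _ _ rs4) ?sub3 ?setU11 // (outP _ _ _ _ rs3) ?setU11.
have s4z3 : s4 z3 = r3 by rewrite (outP _ _ _ _ rs4) ?setU11.
have aP : a \in P0 by rewrite !inE eqxx.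
have bP : b \in P0 by rewrite !inE eqxx ?orbT.
have cP' : c \in P0 by rewrite !inE eqxx ?orbT.
have xP : x0 \in P0 by rewrite !inE eqxx ?orbT.
have SP x : x \in S1 -> x \in P0 by move=> xS; rewrite !inE xS ?orbT.
have NP x : x \in N1 -> x \in P0 by move=> xN; rewrite !inE xN ?orbT.
have S1F x : x \in S1 -> x \notin F0 /\ eY w (s x).
  by move=> /(subsetP S1w)/setDP[xw ->]; split=> //; move: xw; rewrite inE.
have N1F x : x \in N1 -> [/\ x \notin F0, x \notin S1 & eX c x].
  move=> /(subsetP N1c)/setDP[xw]; rewrite in_setU negb_or => /andP[-> ->]; split=> //.
  by move: xw; rewrite inE.
have neP x y : x \in P0 -> y \notin P0 -> x != y.
  by move=> xP1; apply: contraNneq => <-.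
have [z2z1 z2P'] : z2 != z1 /\ z2 \notin P0.
  by apply/andP; rewrite -negb_or; move: z2P; rewrite in_setU1.
have [z3z2 [z3z1 z3P']] : z3 != z2 /\ (z3 != z1 /\ z3 \notin P0).
  by move: z3P; rewrite !in_setU1 !negb_or => /and3P[].
have [z4z3 [z4z2 [z4z1 z4P']]] : z4 != z3 /\ (z4 != z2 /\ (z4 != z1 /\ z4 \notin P0)).
  by move: z4P; rewrite !in_setU1 !negb_or => /and4P[].
pose U := ~: [set a; b].
have inU x : a != x -> b != x -> x \in U.
  by move=> ax bx; rewrite !inE negb_or eq_sym ax eq_sym bx.
have F0U x : x \notin F0 -> x \in U.
  rewrite /F0 !in_setU !negb_or !in_set1 => /andP[/andP[/andP[xa xb] _] _].
  by apply: inU; rewrite eq_sym.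
have zU z : z \notin P0 -> z \in U by move=> zP; apply: inU; apply: neP.
have cU : c \in U by apply: inU.
have xU : x0 \in U by apply: inU.
pose t1 := (tperm c z4 * s4)%g.
have rt1 : reach eX eY U s4 t1.
  by apply: reach_swap; [exact: cU|exact: zU|exact: e4|rewrite s4E // s4z].
have t1c : t1 c = r4 by rewrite permM tpermL s4z.
have t1E x : c != x -> z4 != x -> t1 x = s4 x by move=> cx zx; rewrite permM tpermD.
have cN x : x \in N1 -> c != x.
  by case/N1F=> xF _ _; apply: contraNneq xF => <-; rewrite !inE eqxx ?orbT.
have t1N x : x \in N1 -> t1 x = s x.
  move=> xN; have xP' := NP _ xN; rewrite t1E ?cN ?s4E //.
  by rewrite eq_sym neP.
pose P := c |: (z3 |: N1).
have NP1 : s @: N1 \subset t1 @: P.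
  by apply/subsetP => _ /imsetP[x xN ->]; rewrite -t1N //; apply: imset_f; rewrite !inE xN !orbT.
have r4P : r4 \in t1 @: P by rewrite -t1c imset_f // setU11.
have cz3 : c != z3 by apply: neP.
have t1z3 : t1 z3 = r3 by rewrite t1E.
have r3P : r3 \in t1 @: P by rewrite -t1z3 imset_f // !inE eqxx orbT.
(* All other positions of [P] are adjacent to [c], and the core [K'] of the people on [N1] joins
   [r4] to [r3]. *)
have [t2 rt2 t2c] : exists2 t2, reach eX eY P t1 t2 & t2 c = r3.
  apply: dual_walk; rewrite ?setU11 //.
    move=> x; rewrite in_setU1 => /predU1P[->|]; first by rewrite eqxx.
    by rewrite in_setU1 => /predU1P[-> //|/N1F[]].
  rewrite t1c; move: r4A r3A; rewrite 2!inE.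
  move=> /'exists_andP[k4 [k4K e4']] /'exists_andP[k3 [k3K e3']].
  have coreP k : k \in K' -> k \in t1 @: P.
    by move=> kK; apply: (subsetP NP1); apply: (subsetP (coreS eY th _)) kK.
  apply: (@connect_trans _ _ k4).
    by apply: connect1; rewrite /within /= r4P coreP.
  apply: (@connect_trans _ _ k3).
    by apply: within_connectS NP1 (core_connect eY_sym lkY k4K k3K).
  by apply: connect1; rewrite /within /= r3P coreP // eY_sym.
have t2E x : c != x -> z3 != x -> x \notin N1 -> t2 x = t1 x.
  move=> cx zx xN; apply: reach_out rt2 _.
  by rewrite !in_setU1 !negb_or eq_sym cx eq_sym zx.
have cx0 : c != x0 by rewrite eq_sym.
have F0N x : x \in F0 -> x \notin N1.
  by move=> xF; apply/negP => /N1F[]; rewrite xF.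
have PN x : x \notin P0 -> x \notin N1 by apply: contra; apply: NP.
have neP' x y : x \in P0 -> y \notin P0 -> y != x by move=> *; rewrite eq_sym; apply: neP.
have x0F : x0 \in F0 by rewrite !inE eqxx ?orbT.
have cF : c \in F0 by rewrite !inE eqxx ?orbT.
have t2x0 : t2 x0 = w.
  rewrite (t2E _ cx0 (neP' _ _ xP z3P') (F0N _ x0F)).
  by rewrite (t1E _ cx0 (neP' _ _ xP z4P')) s4E.
have t2z1 : t2 z1 = r1.
  by rewrite (t2E _ (neP _ _ cP' z1P) z3z1 (PN _ z1P)) (t1E _ (neP _ _ cP' z1P) z4z1).
pose t3 := (tperm x0 z1 * t2)%g.
have rt3 : reach eX eY U t2 t3.
  by apply: reach_swap; [exact: xU|exact: zU|exact: e1|rewrite t2x0 t2z1].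
have t3z1 : t3 z1 = w by rewrite permM tpermR.
have t3E x : x0 != x -> z1 != x -> t3 x = t2 x by move=> *; rewrite permM tpermD.
have SF x y : y \in F0 -> x \in S1 -> y != x.
  by move=> yF /S1F[xF _]; apply: contraNneq xF => <-.
have t3S x : x \in S1 -> t3 x = s x.
  move=> xS; have xSP := SP _ xS; have cx := SF _ _ cF xS.
  have xN : x \notin N1 by apply/negP => /N1F[_]; rewrite xS.
  rewrite (t3E _ (SF _ _ x0F xS) (neP' _ _ xSP z1P)) (t2E _ cx (neP' _ _ xSP z3P') xN).
  by rewrite (t1E _ cx (neP' _ _ xSP z4P')) s4E.
have cz2 := neP _ _ cP' z2P'.
have t3z2 : t3 z2 = r2.
  rewrite (t3E _ (neP _ _ xP z2P')) 1?eq_sym // (t2E _ cz2 z3z2 (PN _ z2P')).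
  by rewrite (t1E _ cz2 z4z2).
have [t4 rt4 t4z2] : exists2 t4, reach eX eY (z1 |: (z2 |: S1)) t3 t4 & t4 z2 = w.
  apply: (walk_via eX_sym eX_irr lkX) => //.
  - by apply/subsetP => x xS; rewrite inE t3S //; case: (S1F _ xS).
  - by rewrite inE t3z2.
  - by move: z1A; rewrite inE.
  - by move: z2A; rewrite inE.
have t4c : t4 c = r3.
  rewrite -t2c -(t3E _ x0c (neP' _ _ cP' z1P)); apply: reach_out rt4 _.
  rewrite !in_setU1 !negb_or cz2 (neP _ _ cP' z1P) /=.
  by apply/negP => cS; have := SF _ _ cF cS; rewrite eqxx.
have rt5 : reach eX eY U t4 (tperm z2 c * t4)%g.
  by apply: reach_swap; [exact: zU|exact: cU|rewrite eX_sym|rewrite t4z2 t4c].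
exists (tperm z2 c * t4)%g; last by rewrite permM tpermR.
have subU (Q : {set V}) : {subset P0 <= Q} -> ~: Q \subset U.
  by move=> PQ; rewrite setCS; apply/subsetP => x; rewrite !inE => /orP[]/eqP ->; apply: PQ.
apply: connect_trans (reachS (subU _ _) rs1) _ => //.
apply: connect_trans (reachS (subU _ sub1) rs2) _.
apply: connect_trans (reachS (subU _ _) rs3) _; first by move=> x /sub1/sub2.
apply: connect_trans (reachS (subU _ _) rs4) _; first by move=> x /sub1/sub2/sub3.
apply: connect_trans rt1 _; apply: connect_trans (reachS _ rt2) _.
  by apply/subsetP => x; rewrite !in_setU1 => /or3P[/eqP->|/eqP->|/N1F[/F0U]] //; apply: zU.
apply: connect_trans rt3 _; apply: connect_trans (reachS _ rt4) rt5.
by apply/subsetP => x; rewrite !in_setU1 => /or3P[/eqP->|/eqP->|/S1F[/F0U]] //; apply: zU.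
Qed.

End Transport.

(** * From transports to arbitrary exchanges *)

Definition common_nbrs (V : finType) (e : rel V) :=
  forall a b, a != b -> exists c, e a c && e b c.

Section Exchange.
Variables (V : finType) (eX eY : rel V).
Hypotheses (eX_sym : symmetric eX) (eY_sym : symmetric eY).
Hypotheses (eX_irr : irreflexive eX) (eY_irr : irreflexive eY).
Hypotheses (comX : common_nbrs eX) (comY : common_nbrs eY).
Hypothesis transportP : forall (s : {perm V}) w c a b,
  a != c -> b != c -> s a != w -> s b != w ->
  exists2 t, reach eX eY (~: [set a; b]) s t & t c = w.
Implicit Types (s t : {perm V}).
Local Open Scope group_scope.

Lemma exchange s a b : eX a b -> reach eX eY setT s (tperm a b * s).
Proof.
move=> ab; have aNb : a != b by apply: contraTneq ab => ->; rewrite eX_irr.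
have [c /andP[ac bc]] := comX aNb.
have [w /andP[aw bw]] : exists w, eY (s a) w && eY (s b) w.
  by apply: comY; rewrite (inj_eq perm_inj).
have ne (e : rel V) x y : irreflexive e -> e x y -> x != y.
  by move=> irr exy; apply: contraTneq exy => ->; rewrite irr.
have aNc := ne _ _ _ eX_irr ac; have bNc := ne _ _ _ eX_irr bc.
have [bNa cNa cNb] : [/\ b != a, c != a & c != b] by split; rewrite eq_sym.
have [t rt tc] := transportP aNc bNc (ne _ _ _ eY_irr aw) (ne _ _ _ eY_irr bw).
have aU : a \notin ~: [set a; b] by rewrite !inE eqxx.
have bU : b \notin ~: [set a; b] by rewrite !inE eqxx orbT.
have ta : t a = s a := reach_out rt aU.
have tb : t b = s b := reach_out rt bU.
(* The same transport with the occupants of [a] and [b] exchanged; run backwards, it undoes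
   everything but the exchange. *)
have rt' := reach_conj aU bU rt.
apply: connect_trans (reachS (subsetT _) rt) _.
rewrite /reach reach_sym // in rt'.
apply: connect_trans (reachS (subsetT _) rt').
(* Three swaps in the triangle [a], [b], [c]. Each involves [w], a friend of both others, and [w]
   ends where it started. *)
have -> : tperm a b * t = tperm a c * (tperm a b * (tperm b c * t)).
  apply/permP => x; rewrite !permM.
  have [->|xa] := eqVneq x a.
    by rewrite !tpermL (tpermD aNc bNc) tpermR.
  have [->|xb] := eqVneq x b.
    by rewrite (tpermD aNb cNb) !tpermR (tpermD bNa cNa).
  have [->|xc] := eqVneq x c; first by rewrite (tpermD aNc bNc) tpermR !tpermL.
  by rewrite !tpermD // eq_sym.
set s1 := tperm b c * t; set s2 := tperm a b * s1.
have r1 : reach eX eY setT t s1 by apply: reach_swap; rewrite ?inE // tb tc.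
have r2 : reach eX eY setT s1 s2.
  by apply: reach_swap; rewrite ?inE // !permM tpermL (tpermD bNa cNa) ta tc.
have r3 : reach eX eY setT s2 (tperm a c * s2).
  apply: reach_swap; rewrite ?inE // !permM tpermL tpermL tc.
  by rewrite (tpermD aNc bNc) tpermR tb eY_sym.
exact: connect_trans r1 (connect_trans r2 r3).
Qed.

(** A transposition is conjugate, through a common neighbour, to one along an edge. *)
Lemma exchange_any s a b : reach eX eY setT s (tperm a b * s).
Proof.
have [->|aNb] := eqVneq a b; first by rewrite tperm1 mul1g; apply: connect0.
have [c /andP[ac bc]] := comX aNb.
have -> : tperm a b * s = tperm a c * (tperm b c * (tperm a c * s)).
  rewrite !mulgA; congr (_ * _); rewrite -{1}(tpermV a c) -mulgA -conjgE tpermJ tpermR.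
  by rewrite tpermD // 1?tpermC //; apply: contraTneq bc => ->; rewrite eX_irr.
apply: connect_trans (exchange s ac) _.
by apply: connect_trans (exchange _ bc) _; apply: exchange.
Qed.

Lemma exchange_connected s t : reach eX eY setT s t.
Proof.
rewrite -(mulgKV s t); have [ts -> _] := prod_tpermP (t * s^-1).
elim: ts => [|[a b] ts IH]; first by rewrite big_nil mul1g; apply: connect0.
by rewrite big_cons -mulgA; apply: connect_trans IH _; apply: exchange_any.
Qed.

End Exchange.

(** Here [th] is the linking threshold, [q] bounds the exceptions in [spread], [l] is the block
    length of the colouring, [g] the number of friends of a rich person, [m] and [m'] sizes kept by
    one colour class, and [d] the minimum degree. The last two conditions include [6 * th + 8] for
    the positions a transport protects. *)
Theorem FS_connected_criterion (V : finType) (eX eY : rel V) (th q l g m m' d : nat) :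
  symmetric eX -> symmetric eY -> irreflexive eX -> irreflexive eY ->
  linked eX th -> linked eY th -> spread eX eY th q (m - th) ->
  (forall x, d <= #|nbh eX x|) -> (forall x, d <= #|nbh eY x|) ->
  common_nbrs eX -> common_nbrs eY ->
  0 < th -> 0 < l -> 10 * ((#|V| + 3) * #|V|) * 9 ^ l < 10 ^ l ->
  l * m <= g -> 3 * th <= m -> th * (3 * th) + th + 3 * q <= m' ->
  l * (5 * th) + 7 * th + 8 <= d ->
  l * m' + 6 * th + 8 <= #|V| -> th * g + 7 * th + 8 <= #|V| ->
  forall s t : {perm V}, reach eX eY setT s t.
Proof.
move=> eX_sym eY_sym eX_irr eY_irr lkX lkY spr dX dY cX cY th0 l0 col lm thm thq ld lV thV.
apply: exchange_connected => //; apply: (transport eX_sym eY_sym eX_irr eY_irr lkX lkY dX dY _ ld).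
move=> s U A B cU AU BU cA cB; have := cardsC U => cUV.
by apply: (relay eX_sym eY_sym eX_irr lkX lkY spr th0 l0 col lm thm thq) => //; lia.
Qed.

(** * Packing two sparse graphs *)

(* A bijection with the fewest conflicting edges has none: an end [u] of a conflict
   can be swapped with some vertex [w] without creating a new conflict. *)
Theorem sauer_spencer (V : finType) (eX eY : rel V) (d1 d2 : nat) :
  symmetric eX -> symmetric eY -> irreflexive eX -> irreflexive eY ->
  (forall x, #|nbh eX x| <= d1) -> (forall x, #|nbh eY x| <= d2) ->
  2 * (d1 * d2) < #|V| ->
  exists s : {perm V}, forall a b, eX a b -> ~~ eY (s a) (s b).
Proof.
move=> eX_sym eY_sym eX_irr eY_irr dX dY lt.
pose conf (s : {perm V}) := [set p : V * V | eX p.1 p.2 && eY (s p.1) (s p.2)].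
have [s _ s_min] := @arg_minnP _ 1%g xpredT (fun s => #|conf s|) isT.
exists s => u v uv; apply/negP => suv.
have uNv : u != v by apply: contraTneq uv => ->; rewrite eX_irr.
have card_pre (A : {set V}) : #|s @^-1: A| = #|A|.
  by rewrite -im_permV card_imset //; apply: perm_inj.
(* Swapping [u] with a position outside both sets creates no conflict. Both contain [u], because
   [uv] is a conflict, so their union together with [v] has at most [2 * (d1 * d2)] elements. *)
pose bad1 := \bigcup_(x in nbh eX u) s @^-1: nbh eY (s x).
pose bad2 := \bigcup_(y in s @^-1: nbh eY (s u)) nbh eX y.
have c1 : #|bad1| <= d1 * d2.
  apply: leq_trans (leq_card_bigcup (k := d2) _) _; last by rewrite leq_mul2r dX orbT.
  by move=> x _; rewrite card_pre.
have c2 : #|bad2| <= d1 * d2.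
  apply: leq_trans (leq_card_bigcup (k := d1) _) _; first by move=> x _.
  by rewrite mulnC leq_mul2l card_pre dY orbT.
have u1 : u \in bad1 by apply/bigcupP; exists v; rewrite !inE // eY_sym.
have u2 : u \in bad2 by apply/bigcupP; exists v; rewrite !inE // eX_sym.
have [w wP] : exists w, w \in ~: (v |: (bad1 :|: bad2)).
  apply/card_gt0P; have := cardsC (v |: (bad1 :|: bad2)).
  have : 0 < #|bad1 :&: bad2| by apply/card_gt0P; exists u; rewrite inE u1.
  have := cardsU bad1 bad2; have := subset_leq_card (subsetIl bad1 bad2).
  rewrite cardsU1.
  by case: (_ \notin _) => /=; move: lt c1 c2 {u1 u2 s_min};
    move: #|_ :|: _| #|_ :&: _| #|~: _| #|bad1| #|bad2| #|V| (d1 * d2) => *; lia.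
move: wP; rewrite !inE !negb_or => /and3P[wv w1 w2].
have wu : w != u by apply: contraNneq w1 => ->.
pose s' := (tperm u w * s)%g.
suff : #|conf s'| < #|conf s| by rewrite ltnNge s_min.
apply: proper_card; apply/properP; split; last first.
  exists (u, v); rewrite inE /= ?uv // permM tpermL permM tpermD //.
  by apply: contra w1 => swv; apply/bigcupP; exists v; rewrite !inE // eY_sym.
have new1 b : eX u b -> b != w -> ~~ eY (s w) (s b).
  move=> ub bw; apply: contra w1 => swb; apply/bigcupP; exists b; rewrite !inE //.
  by rewrite eY_sym.
have new2 b : eX w b -> b != u -> ~~ eY (s u) (s b).
  move=> wb bu; apply: contra w2 => sub; apply/bigcupP; exists b; rewrite !inE //.
  by rewrite eX_sym.
apply/subsetP => -[a b]; rewrite !inE /= => /andP[ab]; rewrite ab /= !permM.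
case: (tpermP u w a) ab => [->|->|/eqP au /eqP aw] ab;
  case: (tpermP u w b) ab => [->|->|/eqP bu /eqP bw] ab //.
- by rewrite eX_irr in ab.
- by rewrite eY_sym.
- by move/negP: (new1 _ ab bw).
- by rewrite eY_sym.
- by rewrite eX_irr in ab.
- by move/negP: (new2 _ ab bu).
- by rewrite eY_sym => sab; rewrite eX_sym in ab; move: sab; move/negP: (new1 _ ab aw).
- by rewrite eY_sym => sab; rewrite eX_sym in ab; move: sab; move/negP: (new2 _ ab au).
Qed.

(** * Arithmetic of the parameters *)

Lemma quotient_bounds n c : 0 < c -> c <= n -> c * (n %/ c) <= n /\ n <= 2 * c * (n %/ c).
Proof.
move=> c0 cn; have lt := ltn_pmod n c0; have := divn_eq n c.
have : 0 < n %/ c by rewrite divn_gt0.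
move: (n %/ c) (n %% c) lt => q r lt q0 ->; nia.
Qed.

Section Constants.
Variables (n t L q : nat).
Hypotheses (L_gt0 : 0 < L) (t_gt0 : 0 < t).
Hypothesis Ltn : 100 * 200 * (L * L) * (t * t) <= n.

Lemma constants_base : [/\ 100 * 200 * (L * t * (L * t)) <= n, L <= L * t, t <= L * t
  & L * t <= L * t * (L * t)].
Proof.
have -> : L * t * (L * t) = L * L * (t * t) by rewrite mulnACA.
have LL : L <= L * L by rewrite leq_pmulr.
have tt : t <= t * t by rewrite leq_pmulr.
by split; rewrite ?leq_pmulr ?leq_pmull ?leq_mul // mulnA.
Qed.

Lemma L_bound : 100 * 200 * L <= n.
Proof. by have [] := constants_base; lia. Qed.

Lemma poor_count_bound : t * (40 * L * (300 * L * t)) + 7 * t + 8 <= n.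
Proof.
have [b1 b2 b3 b4] := constants_base.
have -> : t * (40 * L * (300 * L * t)) = 40 * 300 * (L * t * (L * t)) by nia.
lia.
Qed.

Lemma good_count_bound : 200 * L * q <= n ->
  40 * L * (t * (3 * t) + t + 3 * q) + 6 * t + 8 <= n.
Proof.
move=> qn; have [b1 b2 b3 b4] := constants_base.
have -> : 40 * L * (t * (3 * t) + t + 3 * q) =
  120 * (L * (t * t)) + 40 * (L * t) + 120 * (L * q) by nia.
have : L * (t * t) <= L * t * (L * t) by rewrite -!mulnA leq_mul2l mulnCA leq_pmull ?orbT.
lia.
Qed.

Lemma degree_bound : 40 * L * (5 * t) + 7 * t + 8 <= 300 * L * t.
Proof. by have [b1 b2 b3 b4] := constants_base; lia. Qed.

Lemma degree_lt : (300 * L * t).+1 <= n.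
Proof. by have [b1 b2 b3 b4] := constants_base; lia. Qed.

Lemma degree_pred : t * L <= (300 * L * t).-1.
Proof. by have [b1 b2 b3 b4] := constants_base; rewrite mulnC; lia. Qed.

Lemma degree_exponent : (300 * L * t).+2 * L + (300 * L * t).+1 <= 100 * 200 * 8 * L * L * L * t.
Proof.
have [b1 b2 b3 b4] := constants_base.
have -> : (300 * L * t).+2 * L + (300 * L * t).+1 = 300 * (L * t * L) + 2 * L + 300 * (L * t) + 1.
  by nia.
have -> : 100 * 200 * 8 * L * L * L * t = 100 * 200 * 8 * (L * t * L * L) by nia.
have : L * t <= L * t * L by rewrite leq_pmulr.
have : L * t * L <= L * t * L * L by rewrite leq_pmulr.
lia.
Qed.

Lemma mean_degree : 100 * 200 * 8 * L * L * L * t <= 100 * 200 * (L * L) * t * (8 * L).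
Proof. nia. Qed.

Lemma core_bound : 299 * L * t <= 300 * L * t - t.
Proof. by have [b1 b2 b3 b4] := constants_base; lia. Qed.

(** On the left, [4 * n * L] bounds the logarithm of the number of events and [L] is the gain
    sought. The right side is at least [299 * 8 / 400] times [n * L], nearly [6 * n * L]. *)
Lemma spread_exponent : n <= 400 * L * q -> 4 * n * L + L <= 299 * L * q * (8 * L).
Proof.
move=> nq; have [b1 b2 b3 b4] := constants_base.
have : n * L <= 400 * (L * q * L).
  by apply: leq_trans (leq_mul nq (leqnn L)) _; rewrite -!mulnA.
have : L <= n * L by apply: leq_pmull; lia.
have -> : 299 * L * q * (8 * L) = 299 * 8 * (L * q * L) by nia.
have -> : 4 * n * L = 4 * (n * L) by nia.
lia.
Qed.

End Constants.

Lemma common_exponent L : 0 < L -> 2 * L + L <= 8 * L * L.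
Proof. by move=> L0; rewrite -mulnA; have := leq_pmulr L L0; lia. Qed.

Lemma small_colors n : 100 <= n -> 10 * ((n + 3) * n) < n ^ 4.
Proof.
move=> n1; rewrite !expnS expn0 muln1.
have : 100 * (n * n) <= n * (n * (n * n)).
  by apply: leq_mul => //; apply: leq_pmull; lia.
have : n <= n * n by apply: leq_pmull; lia.
have -> : (n + 3) * n = n * n + 3 * n by nia.
lia.
Qed.

(** The left side counts the choices of [s], [W], [Z] and [r] in [spread]. *)
Lemma permutations_bound n : 2 <= n -> n`! * 2 ^ n * (2 ^ n * n ^ n) <= n ^ (4 * n).
Proof.
move=> n2; have two : 2 ^ n <= n ^ n by rewrite leq_exp2r //; lia.
have fac : n`! <= n ^ n.
  rewrite fact_prod (leq_trans (_ : _ <= \prod_(1 <= i < n.+1) n)) //; last first.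
    by rewrite prod_nat_const_nat subn1.
  rewrite big_nat_cond [leqRHS]big_nat_cond; apply: leq_prod => i /andP[/andP[_ lt] _].
  by rewrite -ltnS.
by rewrite (_ : 4 * n = n + n + (n + n)); [rewrite !expnD !leq_mul|lia].
Qed.

(** * Random subsets *)

Import Order.TTheory GRing.Theory Num.Theory.
Local Open Scope ring_scope.

Section RandomSubset.
Variables (T : finType) (G : {set T}).
Implicit Types (C D E F M : {set T}).

Lemma sum_subsets (R : comPzRingType) (a b : R) (H : {set T}) :
  \sum_(E in powerset H) a ^+ #|E| * b ^+ (#|H| - #|E|) = (a + b) ^+ #|H|.
Proof.
rewrite addrC exprDn.
rewrite (partition_big (fun E : {set T} => inord #|E| : 'I_#|H|.+1) xpredT) //=.
apply: eq_bigr => i _.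
have eqi (E : {set T}) : E \subset H -> (inord #|E| == i) = (#|E| == i :> nat).
  by move=> EH; rewrite -val_eqE /= inordK // ltnS subset_leq_card.
rewrite (eq_bigr (fun=> b ^+ (#|H| - i) * a ^+ i)); last first.
  by move=> E; rewrite powersetE => /andP[EH]; rewrite eqi // => /eqP ->; rewrite mulrC.
rewrite sumr_const -cards_draws; congr (_ *+ _); apply: eq_card => E.
by rewrite [in RHS]inE unfold_in /= powersetE; apply: andb_id2l => EH; rewrite eqi.
Qed.

Variable R : realFieldType.
Implicit Types (p x : R).

Definition weight p E : R := p ^+ #|E| * (1 - p) ^+ (#|G| - #|E|).

Definition pr p (P : pred {set T}) : R := \sum_(E in powerset G | P E) weight p E.

(** The weight factors over [D] and its complement, and the outer factor sums to 1 by the binomial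
    theorem. *)
Lemma pr_trace p D F : D \subset G -> F \subset D ->
  pr p [pred E | E :&: D == F] = p ^+ #|F| * (1 - p) ^+ (#|D| - #|F|).
Proof.
move=> DG FD; rewrite /pr.
have disj (E : {set T}) : E \subset G :\: D -> #|F :|: E| = (#|F| + #|E|)%N.
  move=> EGD; apply/eqP; rewrite eqn_leq (leq_card_setU F E).1 /=.
  rewrite cardsU (_ : F :&: E = set0) ?cards0 ?subn0 //.
  apply/setP => x; rewrite !inE; apply/negP => /andP[xF xE].
  by have := subsetP EGD x xE; rewrite inE (subsetP FD).
rewrite (reindex_onto (fun E' => F :|: E') (fun E => E :\: D)) /=; last first.
  move=> E /andP[_ /eqP <-]; apply/setP => x; rewrite !inE.
  by case: (x \in E); case: (x \in D).
rewrite (eq_bigl (fun E => E \in powerset (G :\: D))); last first.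
  move=> E; rewrite !inE; apply/idP/idP.
    case/andP=> /andP[/subsetP FEG _] /eqP <-; apply/subsetP => x; rewrite !inE.
    by case: (x \in D) => //= xFE; apply: FEG; rewrite inE.
  move=> /subsetP EGD; apply/andP; split; first apply/andP; first split.
  - apply/subsetP => x; rewrite inE => /orP[/(subsetP FD)/(subsetP DG)//|/EGD].
    by rewrite inE => /andP[].
  - apply/eqP/setP => x; rewrite !inE; case xF: (x \in F) => /=; first by rewrite (subsetP FD).
    by apply/negP => /andP[/EGD]; rewrite inE => /andP[/negP].
  - apply/eqP/setP => x; rewrite !inE; case xE: (x \in E) => /=.
      by have := EGD x xE; rewrite inE => /andP[-> _]; rewrite orbT.
    by rewrite orbF; apply/negP => /andP[/negP xD /(subsetP FD)].
transitivity (p ^+ #|F| * (1 - p) ^+ (#|D| - #|F|) *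
   \sum_(E in powerset (G :\: D)) p ^+ #|E| * (1 - p) ^+ (#|G :\: D| - #|E|)).
  rewrite mulr_sumr; apply: eq_bigr => E; rewrite powersetE => EGD.
  rewrite /weight disj // exprD -!mulrA; congr (_ * _); rewrite [RHS]mulrCA; congr (_ * _).
  rewrite -exprD; congr (_ ^+ _); have := cardsID D G; rewrite (setIidPr DG).
  have := subset_leq_card FD; have := subset_leq_card EGD; lia.
by rewrite sum_subsets subrKC expr1n mulr1.
Qed.

Section Events.
Variable p : R.
Hypothesis p01 : 0 <= p <= 1.

Lemma weight_ge0 E : 0 <= weight p E.
Proof. by case/andP: p01 => p0 p1; rewrite mulr_ge0 ?exprn_ge0 ?subr_ge0. Qed.

Lemma pr_true : pr p xpredT = 1.
Proof.
rewrite /pr (eq_bigl (fun E => E \in powerset G)); last by move=> E; rewrite andbT.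
by rewrite sum_subsets subrKC expr1n.
Qed.

Lemma pr_sub (P Q : pred {set T}) : (forall E, E \subset G -> P E -> Q E) -> pr p P <= pr p Q.
Proof.
move=> PQ; rewrite /pr big_mkcondr /= [leRHS]big_mkcondr /=.
apply: ler_sum => E; rewrite powersetE => EG; case: ifP => [/(PQ _ EG) -> //|_].
by case: ifP => // _; apply: weight_ge0.
Qed.

Lemma pr_or (P Q : pred {set T}) : pr p (predU P Q) <= pr p P + pr p Q.
Proof.
rewrite /pr big_mkcondr [X in X + _]big_mkcondr [X in _ + X]big_mkcondr /= -big_split /=.
apply: ler_sum => E _; have := weight_ge0 E => w0.
by case: (P E); case: (Q E); rewrite /= ?addr0 ?add0r // lerDl.
Qed.

Lemma pr_exists (I : finType) (D : pred I) (P : I -> pred {set T}) c :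
  (forall i, D i -> pr p (P i) <= c) ->
  pr p [pred E | [exists i, D i && P i E]] <= #|D|%:R * c.
Proof.
move=> Pc; apply: (@le_trans _ _ (\sum_(i | D i) pr p (P i))); last first.
  by rewrite mulr_natl -sumr_const; apply: ler_sum => i; apply: Pc.
rewrite /pr big_mkcondr /=.
rewrite (eq_bigr (fun i => \sum_(E in powerset G) if P i E then weight p E else 0)); last first.
  by move=> i _; rewrite big_mkcondr.
rewrite exchange_big /=; apply: ler_sum => E _; case: ifP => [/existsP[i /andP[Di Pi]]|_].
  rewrite (bigD1 i) //= Pi lerDl; apply: sumr_ge0 => j _.
  by case: ifP => // _; apply: weight_ge0.
by apply: sumr_ge0 => j _; case: ifP => // _; apply: weight_ge0.
Qed.

(* Exposing the part of the random set in [C] determines a set [M _] outside [C],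
   which is then avoided independently. *)
Lemma pr_avoid C (cond : pred {set T}) (M : {set T} -> {set T}) N : C \subset G ->
  (forall F, F \subset C -> cond F -> M F \subset G :\: C /\ N <= #|M F|)%N ->
  pr p [pred E | cond (E :&: C) && [disjoint E & M (E :&: C)]] <= (1 - p) ^+ N.
Proof.
move=> CG MP; have [p0 p1] := andP p01; have q0 : 0 <= 1 - p by rewrite subr_ge0.
rewrite /pr (partition_big (fun E => E :&: C) (fun F => (F \subset C) && cond F)) /=; last first.
  by move=> E /andP[_ /andP[-> _]]; rewrite subsetIr.
apply: (@le_trans _ _ (\sum_(F : {set T} | (F \subset C) && cond F)
    p ^+ #|F| * (1 - p) ^+ (#|C| - #|F|) * (1 - p) ^+ N)).
  apply: ler_sum => F /andP[FC cF]; have [MC NM] := MP F FC cF.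
  have CM : [disjoint C & M F].
    rewrite -setI_eq0; apply/eqP/setP => x; rewrite !inE.
    by apply/negP => /andP[xC /(subsetP MC)]; rewrite inE xC.
  have cCM : #|C :|: M F| = (#|C| + #|M F|)%N by rewrite cardsU (disjoint_setI0 CM) cards0 subn0.
  (* Given the trace [F] on [C], avoiding [M F] says that the trace on the larger set [C :|: M F] is
     still [F]. *)
  rewrite (eq_bigl [pred E in powerset G | E :&: (C :|: M F) == F]); last first.
    move=> E; rewrite /= -andbA; case: (E \in _) => //=; apply/idP/idP.
      move=> /andP[/andP[_ dM] /eqP EC]; rewrite setIUr EC.
      by rewrite EC in dM; rewrite (disjoint_setI0 dM) setU0.
    move=> /eqP EF; have EC : E :&: C = F.
      by rewrite -(setIidPl FC) -{1}EF -setIA (setIidPr (subsetUl _ _)).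
    rewrite EC cF eqxx andbT -setI_eq0; apply/eqP/setP => x; rewrite !inE.
    apply/negP => /andP[xE xM]; have : x \in F by rewrite -EF !inE xE xM orbT.
    by move/(subsetP FC) => xC; have := subsetP MC x xM; rewrite inE xC.
  have -> : \sum_(E in [pred E in powerset G | E :&: (C :|: M F) == F]) weight p E =
      pr p [pred E | E :&: (C :|: M F) == F] by apply: eq_bigl => E.
  rewrite pr_trace; last 2 first.
  - by rewrite subUset CG (subset_trans MC (subsetDl _ _)).
  - by apply: subset_trans FC (subsetUl _ _).
  rewrite cCM -addnBAC ?subset_leq_card // exprD mulrA ler_wpM2l //.
    by rewrite mulr_ge0 ?exprn_ge0.
  by apply: ler_wiXn2l => //; rewrite lerBlDr lerDl.
rewrite -mulr_suml ler_piMl ?exprn_ge0 //.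
apply: (@le_trans _ _ (\sum_(F in powerset C) p ^+ #|F| * (1 - p) ^+ (#|C| - #|F|))); last first.
  by rewrite sum_subsets subrKC expr1n.
rewrite [leRHS](bigID cond) /=; rewrite (eq_bigl [pred F in powerset C | cond F]); last first.
  by move=> F; rewrite /= powersetE.
by rewrite lerDl; apply: sumr_ge0 => F _; rewrite mulr_ge0 ?exprn_ge0.
Qed.

(** The generating function of the binomial variable [#|E :&: D|], from which the Chernoff bound on
    degrees is derived. *)
Lemma pr_exp D x : D \subset G ->
  \sum_(E in powerset G) weight p E * x ^+ #|E :&: D| = (p * x + (1 - p)) ^+ #|D|.
Proof.
move=> DG; rewrite (partition_big (fun E => E :&: D) (fun F => F \in powerset D)) /=; last first.
  by move=> E _; rewrite powersetE subsetIr.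
rewrite -sum_subsets; apply: eq_bigr => F; rewrite powersetE => FD.
rewrite exprMn mulrAC -(pr_trace p DG FD) /pr mulr_suml.
by apply: eq_bigr => E /andP[_ /eqP ->].
Qed.

End Events.
End RandomSubset.

(** * Bad events for a random graph *)

Local Open Scope nat_scope.

Section Pairs.
Variable n : nat.
Local Notation V := ('I_n).
Implicit Types (E F : {set V * V}) (A B S W Z : {set V}).

Definition upair (a b : V) : V * V := if a < b then (a, b) else (b, a).

Lemma upairC a b : upair a b = upair b a.
Proof. by rewrite /upair; case: (ltngtP a b) => // /val_inj ->. Qed.

Lemma upair_all a b : a != b -> upair a b \in all_pairs n.
Proof.
rewrite -val_eqE /= => ab; rewrite inE /upair; case: ifP => //= lt.
by rewrite ltn_neqAle eq_sym ab leqNgt lt.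
Qed.

Lemma adj_sym E : symmetric (adj E).
Proof. by move=> a b; rewrite /adj orbC. Qed.

Lemma adj_irr E : is_graph E -> irreflexive (adj E).
Proof.
move=> /subsetP EG a; rewrite /adj orbb; apply/negP => /EG.
by rewrite inE /= ltnn.
Qed.

Lemma adj_upair E a b : is_graph E -> a != b -> adj E a b = (upair a b \in E).
Proof.
move=> /subsetP EG; rewrite -val_eqE /= => ab; rewrite /adj /upair.
have no (x y : V) : x < y -> (y, x) \in E = false.
  by move=> xy; apply/negP => /EG; rewrite inE /= ltnNge ltnW.
by case: ltngtP ab => // lt _; rewrite (no _ _ lt) //= orbF.
Qed.

Lemma upair_inj a b c d : upair a b = upair c d -> (a = c /\ b = d) \/ (a = d /\ b = c).
Proof. by rewrite /upair; case: ifP; case: ifP => _ _ [-> ->]; [left|right|right|left]. Qed.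

Definition upairs (S : {set V * V}) : {set V * V} := [set upair z.1 z.2 | z in S].

Lemma card_upairs Z W (S : {set V * V}) : [disjoint Z & W] ->
  (forall z, z \in S -> z.1 \in Z /\ z.2 \in W) -> #|upairs S| = #|S|.
Proof.
move=> dZW SZW; apply: card_in_imset => -[a b] [c d] /SZW /= [aZ bW] /SZW /= [cZ dW].
case/upair_inj => [[-> ->] //|[ad _]].
by move/disjointFr: dZW => /(_ _ aZ); rewrite ad dW.
Qed.

Lemma upairs_all (S : {set V * V}) : (forall z, z \in S -> z.1 != z.2) ->
  upairs S \subset all_pairs n.
Proof. by move=> H; apply/subsetP => _ /imsetP[z zS ->]; apply: upair_all; apply: H. Qed.

Lemma disjoint_upairs E (S : {set V * V}) : is_graph E -> (forall z, z \in S -> z.1 != z.2) ->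
  (forall z, z \in S -> ~~ adj E z.1 z.2) -> [disjoint E & upairs S].
Proof.
move=> EG H nadj; rewrite disjoint_sym disjoint_subset; apply/subsetP => _ /imsetP[z zS ->].
by rewrite inE -adj_upair ?H ?nadj.
Qed.

(** The two sets are listed by tuples, so that the union bound has at most a power of [n] terms. *)
Definition poor_pair (E : {set V * V}) k (t : (k.-tuple V) * (k.-tuple V)) :=
  [disjoint E & upairs (setX [set x in t.1] [set x in t.2])].

Definition poor_pair_dom k (t : (k.-tuple V) * (k.-tuple V)) :=
  [&& uniq t.1, uniq t.2 & [disjoint [set x in t.1] & [set x in t.2]]].

Definition unlinked k : pred {set V * V} := fun E =>
  [exists t : (k.-tuple V) * (k.-tuple V), poor_pair_dom t && poor_pair E t].

(** The threshold doubles because two sets of size [2 * k] may overlap, yet contain disjoint subsets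
    of size [k]. *)
Lemma linkedP E k : is_graph E -> ~~ unlinked k E -> linked (adj E) (2 * k).
Proof.
move=> EG /existsPn no A B cA cB.
have [A1 A1A cA1] := @set_sized_subset _ A k ltac:(lia).
have [B1 B1B cB1] : exists2 B1 : {set V}, B1 \subset B :\: A1 & #|B1| = k.
  by apply: subset_setD_sized; rewrite cA1 addnn -mul2n.
pose t1 : k.-tuple V := tcast cA1 (enum_tuple (mem A1)).
pose t2 : k.-tuple V := tcast cB1 (enum_tuple (mem B1)).
have t1E : [set x in t1] = A1.
  by apply/setP => x; rewrite inE memtE /= val_tcast mem_enum.
have t2E : [set x in t2] = B1.
  by apply/setP => x; rewrite inE memtE /= val_tcast mem_enum.
have dAB : [disjoint A1 & B1].
  rewrite -setI_eq0; apply/eqP/setP => x; rewrite !inE; apply/negP => /andP[xA /(subsetP B1B)].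
  by rewrite inE xA.
have := no (t1, t2); rewrite /poor_pair_dom /poor_pair /= t1E t2E dAB !val_tcast !enum_uniq /=.
have [/existsP[[x y] /andP[]]|] := boolP [exists z, (z \in setX A1 B1) && adj E z.1 z.2].
  rewrite inE /= => /andP[xA yB] xy _; exists x, y; split=> //; first exact: (subsetP A1A).
  by have /setDP[] := subsetP B1B y yB.
move=> /existsPn nadj; case/negP; apply: disjoint_upairs => //.
  move=> [x y]; rewrite inE /= => /andP[xA yB]; apply: contraTneq yB => <-.
  by rewrite (disjointFr dAB).
by move=> z zS; have := nadj z; rewrite zS.
Qed.

End Pairs.

Section UnlinkedEvent.
Variables (R : realFieldType) (n : nat) (p : R).
Hypothesis p01 : (0 <= p <= 1)%R.
Local Notation V := ('I_n).
Local Notation G := (all_pairs n).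
Local Notation Pr := (pr G p).

Lemma pr_avoid0 (M : {set V * V}) N : M \subset G -> N <= #|M| ->
  (Pr [pred E : {set V * V} | [disjoint E & M]] <= (1 - p) ^+ N)%R.
Proof.
move=> MG NM; have := @pr_avoid _ G R p p01 set0 xpredT (fun=> M) N (sub0set _).
by apply => F _ _; rewrite setD0.
Qed.

Lemma pr_unlinked k : (Pr (unlinked k) <= (n ^ (2 * k))%:R * (1 - p) ^+ (k * k))%R.
Proof.
apply: le_trans (pr_exists p01 (D := @poor_pair_dom n k) (P := fun t E => poor_pair E t)
  (c := ((1 - p) ^+ (k * k))%R) _) _.
  move=> [t1 t2] /and3P[/= u1 u2 dt]; apply: pr_avoid0.
    apply: upairs_all => -[x y]; rewrite inE /= => /andP[xA yB]; apply: contraTneq yB => <-.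
    by rewrite (disjointFr dt).
  rewrite (@card_upairs _ [set x in t1] [set x in t2]) //; last first.
    by move=> [x y]; rewrite inE /= => /andP[].
  by rewrite cardsX !cardsE (card_uniqP u1) (card_uniqP u2) !size_tuple.
have q0 : (0 <= (1 - p) ^+ (k * k))%R by case/andP: p01 => *; rewrite exprn_ge0 // subr_ge0.
apply: ler_wpM2r => //; rewrite ler_nat.
by apply: leq_trans (max_card _) _; rewrite card_prod !card_tuple card_ord -expnD addnn mul2n.
Qed.

End UnlinkedEvent.

Section LocalEvents.
Variables (R : realFieldType) (n : nat) (p : R).
Hypothesis p01 : (0 <= p <= 1)%R.
Local Notation V := ('I_n).
Local Notation G := (all_pairs n).
Local Notation Pr := (pr G p).
Implicit Types (E F : {set V * V}) (v a b : V) (A : {set V}).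

Let q0 k : (0 <= (1 - p) ^+ k)%R.
Proof. by case/andP: p01 => *; rewrite exprn_ge0 // subr_ge0. Qed.

Definition star v (A : {set V}) : {set V * V} := upairs (setX [set v] A).

Lemma star_all v A : v \notin A -> star v A \subset G.
Proof.
move=> vA; apply: upairs_all => -[x y]; rewrite !inE /= => /andP[/eqP -> yA].
by apply: contraNneq vA => ->.
Qed.

Lemma card_star v A : v \notin A -> #|star v A| = #|A|.
Proof.
move=> vA; rewrite (@card_upairs _ [set v] A) ?cardsX ?cards1 ?mul1n //.
  by rewrite disjoints1.
by move=> [x y]; rewrite inE => /andP[].
Qed.

Lemma disjoint_star E v A : is_graph E -> v \notin A -> (forall x, x \in A -> ~~ adj E v x) ->
  [disjoint E & star v A].
Proof.
move=> EG vA nadj; apply: disjoint_upairs => // -[x y]; rewrite !inE /= => /andP[/eqP -> yA].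
  by apply: contraNneq vA => ->.
exact: nadj.
Qed.

(** The tuple lists all the neighbours that [t.1] is allowed to have. *)
Definition low_degree d : pred {set V * V} := fun E =>
  [exists t : V * (d.-tuple V), true && [disjoint E & star t.1 (~: (t.1 |: [set x in t.2]))]].

Lemma low_degreeP E d : is_graph E -> ~~ low_degree d E -> forall v, d <= #|nbh (adj E) v|.
Proof.
move=> EG /existsPn no v; rewrite leqNgt; apply/negP => lt.
(* The list of neighbours is padded to length [d] with [v], which the star excludes anyway. *)
pose s := enum (nbh (adj E) v) ++ nseq (d - #|nbh (adj E) v|) v.
have sz : size s == d by rewrite size_cat size_nseq -cardE subnKC // ltnW.
case/negP: (no (v, Tuple sz)) => /=; apply: disjoint_star => // [|x].
  by rewrite !inE eqxx.
by rewrite !inE negb_or memtE /= mem_cat negb_or mem_enum inE => /and3P[_ ->].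
Qed.

Lemma pr_low_degree d : (Pr (low_degree d) <= (n ^ d.+1)%:R * (1 - p) ^+ (n - d.+1))%R.
Proof.
apply: le_trans (pr_exists p01 (I := (V * (d.-tuple V))%type) (D := xpredT)
  (P := fun t E => [disjoint E & star t.1 (~: (t.1 |: [set x in t.2]))])
  (c := ((1 - p) ^+ (n - d.+1))%R) _) _.
  move=> [v t] _ /=; have vN : v \notin ~: (v |: [set x in t]) by rewrite !inE eqxx.
  apply: pr_avoid0 => //; rewrite ?star_all // card_star //.
  have cc := cardsC (v |: [set x in t]); rewrite card_ord in cc.
  rewrite leq_subLR -[leqLHS]cc leq_add2r cardsU1 -add1n; apply: leq_add; first exact: leq_b1.
  by rewrite cardsE -[X in _ <= X](size_tuple t); apply: card_size.
by rewrite card_prod card_tuple card_ord expnS.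
Qed.

(** Shaped for [pr_avoid]: the star of [t.1] is exposed first, and the pairs from [t.2] to the
    neighbours so found are then avoided. *)
Definition no_common d : pred {set V * V} := fun E =>
  [exists t : V * V, (t.1 != t.2) &&
    ((d <= #|nbh (adj (E :&: star t.1 (~: [set t.1]))) t.1|) &&
     [disjoint E & star t.2 (nbh (adj (E :&: star t.1 (~: [set t.1]))) t.1 :\ t.2)])].

Lemma adj_star E v x : is_graph E -> adj (E :&: star v (~: [set v])) v x = adj E v x.
Proof.
move=> EG; have EG' : is_graph (E :&: star v (~: [set v])) by apply: subset_trans (subsetIl _ _) EG.
have [->|xv] := eqVneq x v; first by rewrite !adj_irr.
rewrite !adj_upair ?inE 1?eq_sym //; case: (_ \in E) => //=.
by apply/imsetP; exists (v, x); rewrite // !inE eqxx.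
Qed.

Lemma no_commonP E d : is_graph E -> (forall v, d <= #|nbh (adj E) v|) -> ~~ no_common d E ->
  common_nbrs (adj E).
Proof.
move=> EG dE /existsPn no a b ab; apply/existsP; apply: contraT => /existsPn none.
have := no (a, b); rewrite /= ab /=.
have -> : nbh (adj (E :&: star a (~: [set a]))) a = nbh (adj E) a.
  by apply/setP => x; rewrite !inE adj_star.
rewrite dE /= => /negP[]; apply: disjoint_star => // [|x]; first by rewrite !inE eqxx.
by rewrite !inE => /andP[_ ax]; have := none x; rewrite ax.
Qed.

(** The exponent loses one because the second vertex may itself be a neighbour of the first. *)
Lemma pr_no_common d : (Pr (no_common d) <= (n ^ 2)%:R * (1 - p) ^+ d.-1)%R.
Proof.
apply: le_trans (pr_exists p01 (D := fun t : V * V => t.1 != t.2)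
  (P := fun t E => (d <= #|nbh (adj (E :&: star t.1 (~: [set t.1]))) t.1|) &&
     [disjoint E & star t.2 (nbh (adj (E :&: star t.1 (~: [set t.1]))) t.1 :\ t.2)])
  (c := ((1 - p) ^+ d.-1)%R) _) _.
  move=> [a b] /= ab.
  apply: (@pr_avoid _ _ _ _ p01 (star a (~: [set a])) (fun F => d <= #|nbh (adj F) a|)
     (fun F => star b (nbh (adj F) a :\ b))).
    by rewrite star_all // !inE eqxx.
  move=> F FC dF; have FG : is_graph F.
    by apply: subset_trans FC _; rewrite star_all // !inE eqxx.
  have bN : b \notin nbh (adj F) a :\ b by rewrite !inE eqxx.
  split; last first.
    have : d <= 1 + #|nbh (adj F) a :\ b|.
      by apply: leq_trans dF _; rewrite (cardsD1 b) leq_add2r leq_b1.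
    by rewrite card_star //; case: (d).
  apply/subsetP => _ /imsetP[[x y] + ->]; rewrite !inE /= => /andP[/eqP -> /andP[yb ay]].
  have ya : y != a by apply: contraTneq ay => ->; rewrite adj_irr.
  apply/andP; split; last by have := upair_all ya; rewrite eq_sym in yb; have := upair_all yb; rewrite inE.
  apply/imsetP => -[[x' y']]; rewrite !inE /= => /andP[/eqP -> _] /upair_inj[[ba]|[_ ya']].
    by rewrite ba eqxx in ab.
  by rewrite ya' eqxx in ya.
apply: ler_wpM2r => //; rewrite ler_nat.
by apply: leq_trans (max_card _) _; rewrite card_prod card_ord.
Qed.

Lemma eq_core (T : finType) (e e' : rel T) th (S : {set T}) :
  {in S &, e =2 e'} -> core e th S = core e' th S.
Proof.
move=> ee'; have cE x : comp e S x = comp e' S x.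
  apply/setP => y; rewrite !inE; apply: eq_connect => u v; rewrite /within /=.
  by case: (boolP (u \in S)) => //= uS; case: (boolP (v \in S)) => //= vS; apply: ee'.
by apply/setP => x; rewrite !inE cE.
Qed.

Section Spread.
Variables (eY : rel V) (th q ka : nat).
Local Notation I := (({perm V} * {set V}) * ({set V} * {ffun V -> V}))%type.
Implicit Types (i : I).

(** An index [i] packs [((s, W), (Z, r))]. The cores depend only on the edges inside [W], the part
    exposed in [pr_avoid]; the pairs from [Z] to the cores lie outside that part. *)
Definition sp_core i E z := core (adj E) th (friends eY i.1.1 (i.2.2 z) :&: i.1.2).
Definition sp_inner i : {set V * V} := upairs [set z in setX i.1.2 i.1.2 | z.1 != z.2].
Definition sp_edges i E := upairs [set z in setX i.2.1 i.1.2 | z.2 \in sp_core i E z.1].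
Definition sp_cond i E := [forall z in i.2.1, ka <= #|sp_core i E z|].

Definition unspread : pred {set V * V} := fun E =>
  [exists i : I, ((q <= #|i.2.1|) && [disjoint i.2.1 & i.1.2]) &&
    (sp_cond i (E :&: sp_inner i) && [disjoint E & sp_edges i (E :&: sp_inner i)])].

Lemma sp_coreI i E z : is_graph E -> sp_core i (E :&: sp_inner i) z = sp_core i E z.
Proof.
move=> EG; have EG' : is_graph (E :&: sp_inner i) by apply: subset_trans (subsetIl _ _) EG.
apply: eq_core => x y; rewrite !inE => /andP[_ xW] /andP[_ yW].
have [->|xy] := eqVneq x y; first by rewrite !adj_irr.
rewrite !adj_upair // inE; case: (_ \in E) => //=.
by apply/imsetP; exists (x, y); rewrite // !inE /= xW yW.
Qed.

Lemma unspreadP E : is_graph E -> ~~ unspread E -> spread (adj E) eY th q ka.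
Proof.
move=> EG /existsPn no s W Z r cZ dZW coreZ.
have := no ((s, W), (Z, [ffun x => r x])); rewrite /= cZ dZW /=.
have coreE E' z : sp_core ((s, W), (Z, [ffun x => r x])) E' z =
    core (adj E') th (friends eY s (r z) :&: W) by rewrite /sp_core /= ffunE.
have -> : sp_cond (s, W, (Z, [ffun x => r x])) (E :&: sp_inner (s, W, (Z, [ffun x => r x]))).
  by apply/'forall_implyP => z zZ; rewrite sp_coreI // coreE coreZ.
have [/'exists_andP[z [zZ az]]|/existsPn none] :=
  boolP [exists z in Z, attached (adj E) (core (adj E) th (friends eY s (r z) :&: W)) z].
  by exists z.
move=> /= /negP[]; apply: disjoint_upairs => // -[z k]; rewrite 2!inE /= => /andP[/andP[zZ kW]].
  by move=> _; apply: contraTneq kW => <-; rewrite (disjointFr dZW).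
rewrite sp_coreI // coreE => kK; have := none z; rewrite zZ /=; apply: contra => zk.
by apply/'exists_andP; exists k.
Qed.

Lemma pr_unspread :
  (Pr unspread <= (n`! * 2 ^ n * (2 ^ n * n ^ n))%:R * (1 - p) ^+ (q * ka))%R.
Proof.
apply: le_trans (pr_exists p01 (D := fun i : I => (q <= #|i.2.1|) && [disjoint i.2.1 & i.1.2])
  (P := fun i E => sp_cond i (E :&: sp_inner i) && [disjoint E & sp_edges i (E :&: sp_inner i)])
  (c := ((1 - p) ^+ (q * ka))%R) _) _.
  move=> [[s W] [Z r]] /= /andP[cZ dZW]; set i : I := ((s, W), (Z, r)).
  have innG : sp_inner i \subset G.
    by apply: upairs_all => -[x y]; rewrite !inE /= => /andP[].
  apply: (@pr_avoid _ _ _ _ p01 (sp_inner i) (sp_cond i) (sp_edges i)) => // F FC cF.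
  have ZW (z : V * V) : z \in [set z in setX Z W | z.2 \in sp_core i F z.1] ->
      z.1 \in Z /\ z.2 \in W by rewrite 2!inE => /andP[/andP[]].
  split.
    apply/subsetP => _ /imsetP[z /ZW[zZ zW] ->]; rewrite in_setD; apply/andP; split; last first.
      by apply: upair_all; apply: contraTneq zW => <-; rewrite (disjointFr dZW).
    apply/imsetP => -[z']; rewrite 2!inE => /andP[/andP[z1 z2] _].
    by case/upair_inj=> [[e _]|[e _]]; move: (disjointFr dZW zZ); rewrite e ?z1 ?z2.
  rewrite /sp_edges (card_upairs dZW ZW) -sum1_card.
  rewrite (eq_bigl (fun z => (z.1 \in Z) && (z.2 \in sp_core i F z.1))); last first.
    move=> z; rewrite 2!inE -andbA; case: (_ \in Z) => //=.
    apply: andb_idl => zc; have := subsetP (coreS _ _ _) _ zc.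
    by rewrite inE => /andP[].
  rewrite -(pair_big_dep (mem Z) (fun z k => k \in sp_core i F z) (fun _ _ => 1)) /=.
  apply: (@leq_trans (\sum_(z in Z) ka)); first by rewrite sum_nat_const leq_mul2r cZ orbT.
  by apply: leq_sum => z zZ; rewrite sum1_card; have /'forall_implyP := cF; apply.
apply: ler_wpM2r => //; rewrite ler_nat; apply: leq_trans (max_card _) _.
have cS : #|{: {set V}}| = 2 ^ n by rewrite -cardsT -powersetT card_powerset cardsT card_ord.
rewrite !card_prod card_ffun card_ord cS.
by rewrite card_Sn.
Qed.

End Spread.

Definition high_degree k : pred {set V * V} := fun E =>
  [exists v : V, true && (k <= #|E :&: star v (~: [set v])|)].

Lemma high_degreeP E k : is_graph E -> ~~ high_degree k.+1 E ->
  forall v, #|nbh (adj E) v| <= k.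
Proof.
move=> EG /existsPn no v; have := no v; rewrite /= -ltnNge ltnS; apply: leq_trans.
have vN : v \notin nbh (adj E) v by rewrite inE adj_irr.
rewrite -(card_star vN); apply/subset_leq_card/subsetP => _ /imsetP[[x y] + ->].
rewrite !inE /= => /andP[/eqP -> vy]; have vNy : v != y by apply: contraTneq vy => <-; rewrite adj_irr.
rewrite -adj_upair // vy /=; apply/imsetP; exists (v, y); rewrite // !inE eqxx /=.
by rewrite eq_sym.
Qed.

Lemma card_fullstar v : #|star v (~: [set v])| = n.-1.
Proof.
by rewrite card_star ?inE ?eqxx // cardsC1 card_ord.
Qed.

(** Markov's inequality for [x] to the power of the degree. *)
Lemma pr_high_degree k (x : R) : (1 <= x)%R ->
  (Pr (high_degree k) <= n%:R * ((p * x + (1 - p)) ^+ n.-1 / x ^+ k))%R.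
Proof.
move=> x1; have x0 : (0 < x)%R by apply: lt_le_trans x1.
apply: le_trans (pr_exists p01 (D := xpredT) (P := fun v E => k <= #|E :&: star v (~: [set v])|)
  (c := ((p * x + (1 - p)) ^+ n.-1 / x ^+ k)%R) _) _; last by rewrite card_ord.
move=> v _; rewrite ler_pdivlMr ?exprn_gt0 //.
have sG : star v (~: [set v]) \subset G by rewrite star_all // !inE eqxx.
rewrite -(card_fullstar v) -(pr_exp _ _ sG) /pr mulr_suml big_mkcondr /=.
apply: ler_sum => E _; case: ifP => [kE|_]; last first.
  by rewrite mulr_ge0 ?weight_ge0 // exprn_ge0 // ltW.
by apply: ler_wpM2l; [apply: weight_ge0|apply: ler_weXn2l].
Qed.

Definition isolated_vertex v E : bool := [disjoint E & star v (~: [set v])].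

Lemma pr_isolated v : Pr (isolated_vertex v) = ((1 - p) ^+ n.-1)%R.
Proof.
have sG : star v (~: [set v]) \subset G by rewrite star_all // !inE eqxx.
have -> : Pr (isolated_vertex v) = Pr [pred E | E :&: star v (~: [set v]) == set0].
  by apply: eq_bigl => E; rewrite /isolated_vertex -setI_eq0.
by rewrite pr_trace ?sub0set // cards0 expr0 mul1r subn0 card_fullstar.
Qed.

(** The two stars share exactly one pair, [upair u v]. *)
Lemma pr_isolated2 u v : u != v ->
  Pr (fun E => isolated_vertex u E && isolated_vertex v E) = ((1 - p) ^+ (n.-1 + n.-2))%R.
Proof.
move=> uv; set su := star u (~: [set u]); set sv := star v (~: [set v]).
have suG : su \subset G by rewrite star_all // !inE eqxx.
have svG : sv \subset G by rewrite star_all // !inE eqxx.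
have cI : #|su :&: sv| = 1.
  have -> : su :&: sv = [set upair u v].
    apply/setP => z; rewrite in_set1; apply/setIP/eqP => [[]|->].
      move=> /imsetP[[x y] + zE] /imsetP[[x' y'] +]; rewrite zE !in_setX !in_set1 /=.
      move=> /andP[/eqP -> _] /andP[/eqP -> _] /upair_inj[[uv' _]|[_ ->//]].
      by rewrite uv' eqxx in uv.
    split; apply/imsetP; first by exists (u, v); rewrite // in_setX !in_setC1 in_set1 /= eqxx eq_sym.
    exists (v, u); last by rewrite /= upairC.
    by rewrite in_setX in_setC1 in_set1 /= eqxx.
  by rewrite cards1.
have cU : #|su :|: sv| = n.-1 + n.-2.
  rewrite cardsU cI !card_fullstar -subn1 -addnBA ?subn1 //.
  by rewrite -(card_fullstar u) -/su -cI subset_leq_card ?subsetIl.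
have UG : su :|: sv \subset G by rewrite subUset suG.
have -> : Pr (fun E => isolated_vertex u E && isolated_vertex v E) = Pr [pred E | E :&: (su :|: sv) == set0].
  by apply: eq_bigl => E; rewrite /= /isolated_vertex -!setI_eq0 setIUr setU_eq0.
by rewrite pr_trace ?sub0set // cards0 expr0 mul1r subn0 cU.
Qed.

(* Second moment method: the number of isolated vertices has mean [mu]. *)
Lemma pr_no_isolated : (p < 1)%R -> 0 < n ->
  (Pr (fun E => [forall v, ~~ isolated_vertex v E]) <=
    (n%:R * (1 - p) ^+ n.-1)^-1 + p / (1 - p))%R.
Proof.
move=> p1 n0; set a := ((1 - p) ^+ n.-1)%R; set mu := (n%:R * a)%R.
have [p0 _] := andP p01; have r0 : (0 < 1 - p)%R by rewrite subr_gt0.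
have a0 : (0 < a)%R by rewrite exprn_gt0.
have mu0 : (0 < mu)%R by rewrite mulr_gt0 // ltr0n.
pose N E := (\sum_v (isolated_vertex v E)%:R : R)%R.
pose X (f : {set V * V} -> R) := (\sum_(E in powerset G) weight G p E * f E)%R.
have XP (P : pred {set V * V}) : X (fun E => (P E)%:R)%R = Pr P.
  rewrite /X /pr big_mkcondr /=; apply: eq_bigr => E _.
  by case: (P E); rewrite ?mulr1 ?mulr0.
have X1 : X N = mu.
  rewrite /X (eq_bigr (fun E => \sum_v weight G p E * (isolated_vertex v E)%:R)%R); last first.
    by move=> E _; rewrite mulr_sumr.
  rewrite exchange_big /= (eq_bigr (fun=> a)); last by move=> v _; rewrite [LHS]XP pr_isolated.
  by rewrite sumr_const card_ord -mulr_natl.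
(* The exponent [n.-1 + n.-2] is one short of [2 * n.-1]; this costs a factor [1 / (1 - p)], which
   becomes the error [p / (1 - p)]. *)
have X2 : (X (fun E => N E ^+ 2) <= mu + n%:R ^+ 2 * (a ^+ 2 / (1 - p)))%R.
  have -> : (X (fun E => N E ^+ 2) =
      \sum_u \sum_v Pr (fun E => isolated_vertex u E && isolated_vertex v E))%R.
    rewrite /X (eq_bigr (fun E => \sum_u \sum_v
        weight G p E * (isolated_vertex u E && isolated_vertex v E)%:R)%R).
      rewrite exchange_big /=; apply: eq_bigr => u _; rewrite exchange_big /=.
      by apply: eq_bigr => v _; rewrite [LHS]XP.
    move=> E _; rewrite expr2 mulr_suml mulr_sumr; apply: eq_bigr => u _.
    rewrite !mulr_sumr; apply: eq_bigr => v _; by rewrite -natrM mulnb.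
  have -> : (mu + n%:R ^+ 2 * (a ^+ 2 / (1 - p)) = \sum_(u < n) (a + n%:R * (a ^+ 2 / (1 - p))))%R.
    by rewrite sumr_const card_ord -[RHS]mulr_natl /mu; ring.
  apply: ler_sum => u _; rewrite (bigD1 u) //= lerD //.
    by rewrite /a -(pr_isolated u); apply: pr_sub => // E _ /andP[].
  apply: (@le_trans _ _ (\sum_(v | v != u) a ^+ 2 / (1 - p)))%R; last first.
    rewrite sumr_const [leRHS]mulr_natl ler_wpMn2l //; first by rewrite divr_ge0 ?exprn_ge0 ?ltW.
    by apply: leq_trans (max_card _) _; rewrite card_ord.
  apply: ler_sum => v vu; rewrite pr_isolated2 1?eq_sym // ler_pdivlMr // -exprSr -exprM.
  have -> : (n.-1 + n.-2).+1 = n.-1 * 2; last exact: lexx.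
  by move: (ltn_ord u) (ltn_ord v) vu; rewrite -val_eqE /=; lia.
(* Chebyshev's inequality: without isolated vertices the squared deviation of [N] from [mu] equals
   [mu ^+ 2]. *)
rewrite -(ler_pM2r (exprn_gt0 2 mu0)).
have XC : X (fun E => (N E - mu) ^+ 2)%R = (X (fun E => N E ^+ 2) - mu ^+ 2)%R.
  have -> : X (fun E => (N E - mu) ^+ 2)%R = (X (fun E => N E ^+ 2) - X N * mu *+ 2 +
      mu ^+ 2 * X (fun E => true%:R))%R.
    rewrite /X mulr_suml -sumrMnl -sumrB mulr_sumr -big_split /=; apply: eq_bigr => E _.
    by rewrite sqrrB; ring.
  have XT : X (fun E => true%:R)%R = 1%R by rewrite [LHS](XP xpredT) pr_true.
  by rewrite X1 XT; ring.
apply: (@le_trans _ _ (X (fun E => (N E - mu) ^+ 2)))%R.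
  rewrite -XP /X mulr_suml; apply: ler_sum => E _; rewrite -mulrA ler_wpM2l ?weight_ge0 //.
  case: (boolP [forall v, ~~ isolated_vertex v E]) => [/forallP iso|_]; last by rewrite mul0r sqr_ge0.
  by rewrite mul1r /N big1 ?sub0r ?sqrrN // => v _; rewrite (negbTE (iso v)).
rewrite XC; apply: le_trans (lerB X2 (lexx _)) _.
have -> : ((mu^-1 + p / (1 - p)) * mu ^+ 2 = mu + n%:R ^+ 2 * (a ^+ 2 / (1 - p)) - mu ^+ 2)%R.
  by rewrite /mu; field; rewrite -/mu ?gt_eqF // ltr0n.
by [].
Qed.

End LocalEvents.

(** * The two random graphs together *)

From mathcomp Require Import all_classical all_reals all_analysis.
Local Open Scope ring_scope.

Section Joint.
Variables (R : realType) (n : nat) (p1 p2 : R).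
Hypotheses (p1_01 : 0 <= p1 <= 1) (p2_01 : 0 <= p2 <= 1).
Local Notation T := ('I_n * 'I_n)%type.
Local Notation G := (all_pairs n).
Implicit Types (P C : {set T} -> {set T} -> bool) (A B : pred {set T}).

Definition joint P : R := \sum_(X in powerset G) \sum_(Y in powerset G)
  (if P X Y then gnp_weight p1 X * gnp_weight p2 Y else 0).

(** Bad events of one graph are bounded separately. An event involving both is bounded over [X] for
    each fixed [Y], which independence permits. *)
Lemma joint_le P C A B c :
  (forall X Y, is_graph X -> is_graph Y -> P X Y -> [|| A X, B Y | C X Y]) ->
  (forall Y, is_graph Y -> pr G p1 (C^~ Y) <= c) ->
  joint P <= pr G p1 A + pr G p2 B + c.
Proof.
move=> PABC Cc.
pose w1 X := weight G p1 X; pose w2 Y := weight G p2 Y.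
have w1_ge0 X : 0 <= w1 X by apply: weight_ge0.
have w2_ge0 Y : 0 <= w2 Y by apply: weight_ge0.
have sum1 (p : R) : \sum_(Y in powerset G) weight G p Y = 1.
  by rewrite -(pr_true G p) /pr; apply: eq_bigl => Y; rewrite andbT.
have sA : pr G p1 A = \sum_(X in powerset G) \sum_(Y in powerset G) (A X)%:R * (w1 X * w2 Y).
  rewrite /pr big_mkcondr; apply: eq_bigr => X _ /=.
  rewrite -!mulr_sumr sum1 mulr1; by case: (A X); rewrite ?mul1r ?mul0r.
have sB : pr G p2 B = \sum_(X in powerset G) \sum_(Y in powerset G) (B Y)%:R * (w1 X * w2 Y).
  rewrite exchange_big /pr big_mkcondr; apply: eq_bigr => Y _ /=.
  rewrite -!mulr_sumr -mulr_suml sum1 mul1r; by case: (B Y); rewrite ?mul1r ?mul0r.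
have sC : \sum_(X in powerset G) \sum_(Y in powerset G) (C X Y)%:R * (w1 X * w2 Y) <= c.
  rewrite exchange_big -[leRHS]mul1r -[X in X * c](sum1 p2) mulr_suml; apply: ler_sum => Y.
  rewrite powersetE => YG; rewrite (eq_bigr (fun X => w2 Y * ((C X Y)%:R * w1 X))); last first.
    by move=> X _; rewrite mulrA mulrC.
  rewrite -mulr_sumr ler_wpM2l //; apply: le_trans (Cc Y YG); rewrite /pr big_mkcondr.
  by apply: ler_sum => X _; case: (C X Y); rewrite ?mul1r ?mul0r.
apply: le_trans (lerD (lexx _) sC); rewrite sA sB -!big_split /=; apply: ler_sum => X.
rewrite powersetE => XG; rewrite -!big_split /=; apply: ler_sum => Y; rewrite powersetE => YG.
rewrite -!mulrDl; case: ifP => [/(PABC _ _ XG YG) abc|_]; last first.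
  by apply: mulr_ge0; [rewrite -!natrD ler0n|apply: mulr_ge0].
apply: (@le_trans _ _ (1 * (w1 X * w2 Y))); first by rewrite mul1r.
apply: ler_wpM2r; first exact: mulr_ge0.
rewrite -!natrD ler1n.
by case/or3P: abc => ->; rewrite ?addn_gt0 ?lt0b ?orbT.
Qed.

Lemma joint_compl : joint (fun X Y => FS_connected X Y) + joint (fun X Y => ~~ FS_connected X Y) = 1.
Proof.
rewrite /joint -big_split /=.
have sum1 (p : R) : \sum_(Y in powerset G) gnp_weight p Y = 1.
  by rewrite -(pr_true G p) /pr; apply: eq_bigl => Y; rewrite andbT.
rewrite -(sum1 p1); apply: eq_bigr => X _; rewrite -big_split /= -[RHS]mulr1 -(sum1 p2) mulr_sumr.
by apply: eq_bigr => Y _; case: FS_connected; rewrite ?addr0 ?add0r.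
Qed.

Lemma joint_ge0 P : 0 <= joint P.
Proof.
apply: sumr_ge0 => X _; apply: sumr_ge0 => Y _; case: ifP => // _.
by rewrite mulr_ge0 //; apply: (weight_ge0 G).
Qed.

End Joint.

Lemma FS_connected_reach n (X Y : {set 'I_n * 'I_n}) :
  (forall s t, reach (adj X) (adj Y) finset.setT s t) -> FS_connected X Y.
Proof.
move=> H; apply/forallP => s; apply/forallP => t.
apply: connect_sub (H s t) => {}s {}t /stepP[a [b [_ _ ab sab ->]]].
apply: connect1; apply/existsP; exists a; apply/existsP; exists b; rewrite ab sab /=.
apply/forallP => c; rewrite permM.
by case: tpermP => [->|->|/eqP/negbTE -> /eqP/negbTE ->]; rewrite ?eqxx //; case: ifP => [/eqP ->|].
Qed.

Section Estimates.
Variable R : realType.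

Lemma onem_expR (p p' : R) N : 0 <= p -> p <= p' -> p' <= 1 -> (1 - p') ^+ N <= expR (- (p * N%:R)).
Proof.
move=> p0 pp' p'1; rewrite -mulNr mulrC expRM_natl; apply: lerXn2r.
- by rewrite nnegrE subr_ge0.
- by rewrite nnegrE expR_ge0.
- by apply: le_trans (expR_ge1Dx _); lra.
Qed.

Lemma union_expR (n a N : nat) (L p p' c : R) : n%:R <= expR L ->
  0 <= p -> p <= p' -> p' <= 1 -> a%:R * L + c <= p * N%:R ->
  (n ^ a)%:R * (1 - p') ^+ N <= expR (- c).
Proof.
move=> nL p0 pp' p'1 le.
apply: (@le_trans _ _ (expR (a%:R * L) * expR (- (p * N%:R)))).
  apply: ler_pM; rewrite ?ler0n ?exprn_ge0 ?subr_ge0 ?onem_expR //.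
  by rewrite natrX expRM_natl; apply: lerXn2r; rewrite ?nnegrE ?expR_ge0 ?ler0n.
by rewrite -expRD ler_expR; lra.
Qed.

End Estimates.

(** * Failure probability in the dense regime *)

Section ConnectedEstimate.
Variables (R : realType) (n k L : nat) (p p1 p2 : R).
Local Notation t := (2 * k)%N.
Hypotheses (p_gt0 : 0 < p) (pp1 : p <= p1) (pp2 : p <= p2) (p1_le1 : p1 <= 1) (p2_le1 : p2 <= 1).
Hypotheses (L_gt0 : (0 < L)%N) (nL : n%:R <= expR L%:R :> R).
Hypothesis ptL : (8 * L)%:R <= p * t%:R.
Hypothesis Ltn : (100 * 200 * (L * L) * (t * t) <= n)%N.

(** The block length [l] is of the order of [L], an upper bound for [ln n]. The number [m] serves
    both as the size of a colour class of friends and as the minimum degree; [q] is a fraction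
    [1 / (200 * L)] of the positions. *)
Local Notation l := (40 * L)%N.
Local Notation m := (300 * L * t)%N.
Local Notation q := (n %/ (200 * L))%N.

Let t_gt0 : (0 < t)%N.
Proof.
rewrite lt0n; apply/eqP => k0; move: ptL; rewrite k0 mulr0 leNgt ltr0n.
by rewrite muln_gt0 L_gt0.
Qed.

Let n_big : (100 <= n)%N.
Proof.
apply: leq_trans (L_bound L_gt0 t_gt0 Ltn); rewrite -mulnA leq_pmulr //.
by rewrite muln_gt0 L_gt0.
Qed.

Let q_bounds : (200 * L * q <= n)%N /\ (n <= 400 * L * q)%N.
Proof.
have := @quotient_bounds n (200 * L); rewrite muln_gt0 L_gt0 mulnA => /(_ isT); apply.
apply: leq_trans (L_bound L_gt0 t_gt0 Ltn); rewrite leq_mul2r; apply/orP; right.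
by rewrite leq_pmull.
Qed.

(** As [9 / 10] is at most [expR (- (1 / 10))], the power [40 * L] gains a factor [expR (- 4 L)], at
    most [n ^ -4]. *)
Lemma enough_colors : (10 * ((n + 3) * n) * 9 ^ l < 10 ^ l)%N.
Proof.
rewrite -(ltr_nat R) natrM !natrX.
have e9 : (9%:R : R) ^+ l <= 10%:R ^+ l * expR (- L%:R) ^+ 4.
  have -> : 9%:R = 10%:R * (9%:R / 10%:R) :> R by lra.
  rewrite exprMn ler_wpM2l ?exprn_ge0 ?ler0n //.
  apply: (@le_trans _ _ (expR (- (1 / 10)) ^+ l)).
    apply: lerXn2r; [by rewrite nnegrE divr_ge0|by rewrite nnegrE expR_ge0|].
    by apply: le_trans (expR_ge1Dx _); lra.
  rewrite -!expRM_natl ler_expR natrM; lra.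
apply: (@le_lt_trans _ _ ((10 * ((n + 3) * n))%:R * (10%:R ^+ l * expR (- L%:R) ^+ 4))).
  by rewrite ler_wpM2l ?ler0n.
rewrite mulrCA -[ltRHS]mulr1 ltr_pM2l ?exprn_gt0 ?ltr0n //.
rewrite expRN exprVn ltr_pdivrMr ?exprn_gt0 ?expR_gt0 // mul1r.
apply: (@lt_le_trans _ _ (n%:R ^+ 4)); last by apply: lerXn2r; rewrite ?nnegrE ?ler0n ?expR_ge0.
by rewrite -natrX ltr_nat small_colors.
Qed.

Definition irregular : pred {set 'I_n * 'I_n} :=
  predU (unlinked k) (predU (low_degree m) (no_common m)).

Let pn_ge : (100 * 200 * 8 * L * L * L * t)%:R <= p * n%:R.
Proof.
apply: (@le_trans _ _ (p * (100 * 200 * (L * L) * (t * t))%:R)); last first.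
  by apply: ler_wpM2l; [exact: ltW|rewrite ler_nat].
have -> : p * (100 * 200 * (L * L) * (t * t))%:R = (100 * 200 * (L * L) * t)%:R * (p * t%:R).
  by rewrite [in RHS]mulrCA -natrM -[in RHS](mulnA _ t t).
apply: le_trans (ler_wpM2l (ler0n _ _) ptL); rewrite -natrM ler_nat; exact: mean_degree.
Qed.

Lemma pr_irregular p' : p <= p' -> p' <= 1 ->
  pr (all_pairs n) p' irregular <= 3 * expR (- L%:R).
Proof.
move=> pp' p'1; have p01 : 0 <= p' <= 1 by rewrite p'1 (le_trans (ltW p_gt0)).
have p0 := ltW p_gt0; have ple1 := le_trans pp' p'1.
rewrite /irregular; apply: le_trans (@pr_or _ _ _ _ p01 _ _) _; rewrite (_ : 3 = 1 + (1 + 1)); last by lra.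
rewrite !mulrDl !mul1r; apply: lerD.
  apply: le_trans (@pr_unlinked _ _ _ p01 k) _; apply: (union_expR nL p0 pp' p'1).
  have k1 : (1 <= k%:R :> R) by rewrite ler1n; move: t_gt0; rewrite muln_gt0.
  have L0 : (0 <= L%:R :> R) by [].
  have : (8 * L)%:R * k%:R <= p * t%:R * k%:R by apply: ler_wpM2r.
  rewrite !natrM => h; have : L%:R <= L%:R * k%:R :> R by rewrite ler_peMr.
  lra.
apply: le_trans (@pr_or _ _ _ _ p01 _ _) _; apply: lerD.
  apply: le_trans (@pr_low_degree _ _ _ p01 m) _; apply: (union_expR nL p0 pp' p'1).
  rewrite natrB ?(degree_lt L_gt0 t_gt0 Ltn) // mulrBr.
  have : p * m.+1%:R <= m.+1%:R := ler_piMl (ler0n _ _) ple1.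
  have : (m.+2 * L + m.+1)%:R <= p * n%:R :> R.
    by apply: le_trans pn_ge; rewrite ler_nat (degree_exponent L_gt0 t_gt0 Ltn).
  rewrite natrD natrM -[m.+2]addn1 natrD; move: (m.+1%:R : R) => M; lra.
apply: le_trans (@pr_no_common _ _ _ p01 m) _; apply: (union_expR nL p0 pp' p'1).
have m1 : (t * L <= m.-1)%N := degree_pred L_gt0 t_gt0 Ltn.
apply: (@le_trans _ _ (p * (t * L)%:R)); last by apply: ler_wpM2l; [|rewrite ler_nat].
rewrite natrM mulrA; apply: le_trans (ler_wpM2r (ler0n _ _) ptL).
by rewrite -natrM -natrM -natrD ler_nat common_exponent.
Qed.

Lemma pr_unspread_small (Y : {set 'I_n * 'I_n}) :
  pr (all_pairs n) p1 (unspread (adj Y) t q (m - t)) <= expR (- L%:R).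
Proof.
have p0 := ltW p_gt0; have p01 : 0 <= p1 <= 1 by rewrite p1_le1 (le_trans p0).
apply: le_trans (@pr_unspread _ _ _ p01 _ _ _ _) _.
apply: (@le_trans _ _ ((n ^ (4 * n))%:R * (1 - p1) ^+ (q * (m - t)))).
  apply: ler_wpM2r; first by rewrite exprn_ge0 // subr_ge0.
  by rewrite ler_nat permutations_bound // (leq_trans _ n_big).
apply: (union_expR nL p0 pp1 p1_le1).
have [q1 q2] := q_bounds.
apply: (@le_trans _ _ (p * ((299 * L * q)%:R * t%:R))); last first.
  apply: ler_wpM2l => //; rewrite -natrM ler_nat [leqRHS]mulnC -mulnA [(q * t)%N]mulnC mulnA.
  by rewrite leq_mul2r (core_bound L_gt0 t_gt0 Ltn) orbT.
rewrite mulrCA; apply: le_trans (ler_wpM2l (ler0n _ _) ptL).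
by rewrite -!natrM -natrD ler_nat (spread_exponent L_gt0 t_gt0 Ltn).
Qed.

(** Three irregularities for each of the two graphs, and the failure of [spread], make seven
    terms. *)
Lemma prob_disconnected_small : prob_FS_disconnected n p1 p2 <= 7 * expR (- L%:R).
Proof.
have p0 := ltW p_gt0.
have p1_01 : 0 <= p1 <= 1 by rewrite p1_le1 (le_trans p0).
have p2_01 : 0 <= p2 <= 1 by rewrite p2_le1 (le_trans p0).
apply: (@le_trans _ _ (pr (all_pairs n) p1 irregular + pr (all_pairs n) p2 irregular
    + expR (- L%:R))); last first.
  have := pr_irregular pp1 p1_le1; have := pr_irregular pp2 p2_le1.
  move: (expR _) => e; lra.
apply: (joint_le p1_01 p2_01 (C := fun X Y => unspread (adj Y) t q (m - t) X)) =>
  [X Y XG YG|Y YG]; last first.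
  exact: pr_unspread_small.
apply: contraNT; rewrite /irregular /= !negb_or => /and3P[/and3P[u1 d1 c1] /and3P[u2 d2 c2] s].
apply: FS_connected_reach; have [q1 q2] := q_bounds.
have dX := low_degreeP XG d1; have dY := low_degreeP YG d2.
apply: (@FS_connected_criterion _ _ _ t q l (l * m) m (t * (3 * t) + t + 3 * q) m) => //.
- exact: adj_sym.
- exact: adj_sym.
- exact: adj_irr.
- exact: adj_irr.
- exact: linkedP.
- exact: linkedP.
- exact: unspreadP.
- exact: no_commonP dX c1.
- exact: no_commonP dY c2.
- by rewrite muln_gt0.
- by rewrite card_ord enough_colors.
- by rewrite leq_mul2r -[leqLHS]muln1 leq_mul ?orbT.
- exact: (degree_bound L_gt0 t_gt0 Ltn).
- by rewrite card_ord; apply: (good_count_bound L_gt0 t_gt0 Ltn).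
- by rewrite card_ord; apply: (poor_count_bound L_gt0 t_gt0 Ltn).
Qed.

End ConnectedEstimate.

(** * Obstructions to connectedness *)

Section Disconnected.
Variable n : nat.
Hypothesis n2 : (1 < n)%N.
Implicit Types X Y : {set 'I_n * 'I_n}.

Lemma other_vertex (v : 'I_n) : exists w, w != v.
Proof.
have : (0 < #|[set~ v]|)%N by rewrite cardsC1 card_ord -ltnS prednK // ltnW.
by case/card_gt0P => w; rewrite !inE; exists w.
Qed.

(** The occupant of [v] never changes on a path from [s], but it differs in [tperm v w * s]. *)
Lemma frozen_disconnected X Y (s : {perm 'I_n}) (v : 'I_n) :
  (forall t u : {perm _}, t v = s v -> fs_edge X Y t u -> u v = t v) -> ~~ FS_connected X Y.
Proof.
move=> frozen; have [w wv] := other_vertex v; apply/forallP => /(_ s)/forallP/(_ (tperm v w * s)%g).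
have fix_v (p : seq {perm 'I_n}) (t : {perm 'I_n}) :
    t v = s v -> path (fs_edge X Y) t p -> last t p v = s v.
  elim: p t => [|u p IH] t //= tv /andP[tu pu].
  by apply: IH => //; rewrite (frozen t u tv tu).
move=> /connectP[p /(fix_v _ _ erefl) + e]; rewrite -e permM tpermL => /perm_inj wv'.
by rewrite wv' eqxx in wv.
Qed.

Lemma isolatedP X (v a : 'I_n) : is_graph X -> isolated_vertex v X -> adj X v a = false.
Proof.
move=> XG iso; apply/negP => va.
have vNa : v != a by apply: contraTneq va => <-; rewrite adj_irr.
have vaX : upair v a \in X by rewrite -adj_upair.
have /negP := disjointFr iso vaX; apply.
by apply/imsetP; exists (v, a); rewrite // !inE /= eqxx eq_sym.
Qed.

Lemma isolated_left X Y (v : 'I_n) : is_graph X -> isolated_vertex v X -> ~~ FS_connected X Y.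
Proof.
move=> XG iso; apply: (@frozen_disconnected _ _ 1%g v) => t u _.
move=> /existsP[a /existsP[b /and3P[ab _ /forallP/(_ v)/eqP ->]]].
case: eqP => [va|_]; first by rewrite -va isolatedP in ab.
by case: eqP => [vb|_] //; rewrite adj_sym -vb isolatedP in ab.
Qed.

Lemma isolated_right X Y (v : 'I_n) : is_graph Y -> isolated_vertex v Y -> ~~ FS_connected X Y.
Proof.
(* Starting from the identity, the friendless person [v] stands at the position [v]. *)
move=> YG iso; apply: (@frozen_disconnected _ _ 1%g v) => t u; rewrite perm1 => tv.
move=> /existsP[a /existsP[b /and3P[_ ab /forallP/(_ v)/eqP ->]]].
case: eqP => [va|_]; first by rewrite -va tv isolatedP in ab.
by case: eqP => [vb|_] //; rewrite adj_sym -vb tv isolatedP in ab.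
Qed.

Lemma low_degrees_disconnected X Y d1 d2 : is_graph X -> is_graph Y ->
  ~~ high_degree d1.+1 X -> ~~ high_degree d2.+1 Y -> (2 * (d1 * d2) < n)%N ->
  ~~ FS_connected X Y.
Proof.
move=> XG YG hX hY lt; have v : 'I_n by exists 0%N; apply: ltnW.
have [|s sP] := sauer_spencer (adj_sym X) (adj_sym Y) (adj_irr XG) (adj_irr YG)
  (high_degreeP XG hX) (high_degreeP YG hY); first by rewrite card_ord.
have [w wv] := other_vertex v; apply/forallP => /(_ s)/forallP/(_ (tperm v w * s)%g).
move=> /connectP[[|u p] /=]; last first.
  by case/andP=> /existsP[a /existsP[b /and3P[ab sab _]]]; have := sP _ _ ab; rewrite sab.
move=> _ e; have : (tperm v w * s)%g v = s v by rewrite e.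
by rewrite permM tpermL => /perm_inj wv'; rewrite wv' eqxx in wv.
Qed.

End Disconnected.

(** * Bounds on the probability of connectedness *)

Section ConnectedUpperBounds.
Variables (R : realType) (n : nat).
Hypothesis n2 : (1 < n)%N.

(** Chernoff's bound, with [ln x] replaced by its lower bound [1 - x^-1]. *)
Lemma pr_high_degree_exp (p x : R) k : 0 <= p <= 1 -> 1 < x ->
  pr (all_pairs n) p (high_degree k) <=
    n%:R * expR (p * n%:R * (x - 1) - k%:R * (1 - x^-1)).
Proof.
move=> p01 x1; have [p0 _] := andP p01; have x0 : 0 < x by lra.
apply: le_trans (@pr_high_degree _ _ _ p01 k x (ltW x1)) _.
rewrite ler_wpM2l ?ler0n // expRB; apply: ler_pM.
- by rewrite exprn_ge0 //; nra.
- by rewrite invr_ge0 exprn_ge0 // ltW.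
- apply: (@le_trans _ _ (expR (p * (x - 1)) ^+ n.-1)).
    apply: lerXn2r; rewrite ?nnegrE ?expR_ge0 //; first by nra.
    by apply: le_trans (expR_ge1Dx _); lra.
  rewrite -expRM_natl ler_expR [leRHS]mulrAC [leRHS]mulrC ler_wpM2r //; first by nra.
  by rewrite ler_nat leq_pred.
- rewrite lef_pV2 ?posrE ?exprn_gt0 ?expR_gt0 //.
  rewrite expRM_natl; apply: lerXn2r; [by rewrite nnegrE expR_ge0|by rewrite nnegrE ltW|].
  rewrite -[leRHS]invrK -[leLHS]invrK lef_pV2 ?posrE ?invr_gt0 ?expR_gt0 // -expRN.
  by apply: le_trans (expR_ge1Dx _); lra.
Qed.

Lemma prob_connected_packing (p1 p2 : R) d1 d2 : 0 <= p1 <= 1 -> 0 <= p2 <= 1 ->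
  (2 * (d1 * d2) < n)%N ->
  prob_FS_connected n p1 p2 <=
    pr (all_pairs n) p1 (high_degree d1.+1) + pr (all_pairs n) p2 (high_degree d2.+1).
Proof.
move=> p1_01 p2_01 lt; rewrite -[leRHS]addr0.
apply: (joint_le p1_01 p2_01 (C := fun _ _ => false)) => [X Y XG YG|Y YG].
  rewrite orbF; apply: contraTT; rewrite negb_or => /andP[hX hY].
  exact: low_degrees_disconnected hX hY lt.
by rewrite /pr big1 // => E; rewrite andbF.
Qed.

Lemma prob_connected_isolated (p1 p2 : R) : 0 <= p1 <= 1 -> 0 <= p2 <= 1 -> Num.min p1 p2 < 1 ->
  prob_FS_connected n p1 p2 <=
    (n%:R * (1 - Num.min p1 p2) ^+ n.-1)^-1 + Num.min p1 p2 / (1 - Num.min p1 p2).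
Proof.
move=> p1_01 p2_01; have n0 := ltnW n2.
have none p : pr (all_pairs n) p (fun=> false) = 0 :> R by rewrite /pr big1 // => E; rewrite andbF.
rewrite /Num.min; case: ifP => _ pm.
  apply: le_trans (pr_no_isolated p1_01 pm n0).
  rewrite -[leRHS]addr0 -(none p2) -[leRHS]addr0.
  apply: (joint_le p1_01 p2_01 (C := fun _ _ => false)) => [X Y XG YG|Y YG]; last by rewrite none.
  rewrite orbF /= orbF => conn; apply/forallP => v; apply: contraL conn; exact: isolated_left.
apply: le_trans (pr_no_isolated p2_01 pm n0).
rewrite -[leRHS]add0r -(none p1) -[leRHS]addr0.
apply: (joint_le p1_01 p2_01 (C := fun _ _ => false)) => [X Y XG YG|Y YG]; last by rewrite none.
rewrite orbF /= => conn; apply/forallP => v; apply: contraL conn; exact: isolated_right.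
Qed.

End ConnectedUpperBounds.

(** * Asymptotic estimates *)

Import numFieldNormedType.Exports.
Local Open Scope classical_set_scope.
Local Open Scope ring_scope.

Section Asymptotics.
Variable R : realType.
Implicit Types (p : R) (n : nat).

Lemma near_ln (C : R) : \forall n \near \oo, C <= ln (n%:R : R).
Proof.
have := nbhs_infty_ger (expR C); apply: filterS => n Cn.
by rewrite -[C]expRK ler_ln // posrE ?expR_gt0 // (lt_le_trans (expR_gt0 C)).
Qed.

Lemma ln_gt0_nat n : 0 < ln (n%:R : R) -> (1 < n)%N.
Proof. by case: n => [|[|n]] //; [rewrite ln0 // ltxx|rewrite mulr1n ln1 ltxx]. Qed.

Lemma ln_le_nat n : ln (n%:R : R) <= n%:R.
Proof.
have [->|n0] := posnP n; first by rewrite ln0.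
by rewrite -ler_expR lnK ?posrE ?ltr0n //; apply: le_trans (expR_ge1Dx _); lra.
Qed.

(** [L] is [ln n] and [k] is [4 * L / p], both rounded up. The size condition on [n] then asks for a
    constant times [(ln n) ^ 4 / p ^ 2]. *)
Lemma parameters_exist n p : 0 < p -> p <= 1 -> 1 <= ln (n%:R : R) ->
  200%:R * 200%:R * 1000%:R * ln (n%:R : R) ^+ 4 <= n%:R * p ^+ 2 ->
  exists k L, [/\ (0 < L)%N, n%:R <= expR L%:R :> R, (8 * L)%:R <= p * (2 * k)%:R
    & (100 * 200 * (L * L) * (2 * k * (2 * k)) <= n)%N].
Proof.
move=> p0 p1; set lg := ln n%:R => lg1 le.
have n1 : (1 < n)%N by apply: ln_gt0_nat; rewrite -/lg; lra.
have [L [L0 Lge Lle]] : exists L, [/\ (0 < L)%N, lg <= L%:R & L%:R <= 2 * lg].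
  exists (Num.truncn lg).+1; split=> //; first by rewrite ltW // truncnS_gt.
  have : (Num.truncn lg)%:R <= lg by rewrite truncn_le; lra.
  by rewrite -natr1; lra.
have L1 : 1 <= L%:R :> R by rewrite ler1n.
have x0 : 0 <= 4 * L%:R / p by rewrite divr_ge0 ?mulr_ge0 // ltW.
have [k [kge kle]] : exists k, 4 * L%:R / p <= k%:R /\ k%:R <= 4 * L%:R / p + 1.
  exists (Num.truncn (4 * L%:R / p)).+1; split; first by rewrite ltW // truncnS_gt.
  by rewrite -natr1 lerD2r truncn_le.
rewrite ler_pdivrMr // in kge.
have kp : k%:R * p <= 5 * L%:R.
  have : k%:R * p <= (4 * L%:R / p + 1) * p by rewrite ler_pM2r.
  by rewrite mulrDl divfK ?gt_eqF // mul1r; lra.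
exists k, L; split=> //.
- by apply: le_trans (_ : expR lg <= _); rewrite ?ler_expR // lnK // posrE ltr0n ltnW.
- by rewrite !natrM; lra.
rewrite -(ler_nat R) !natrM; set l := L%:R in L1 Lle Lge kge kp *; set K := k%:R in kge kp *.
have p2 : 0 < p ^+ 2 by rewrite exprn_gt0.
rewrite -(ler_pM2r p2); apply: le_trans le.
have -> : 100%:R * 200%:R * (l * l) * (2%:R * K * (2%:R * K)) * p ^+ 2 =
    400%:R * 200%:R * ((l * (K * p)) ^+ 2) by ring.
have lKp : 0 <= l * (K * p) by rewrite !mulr_ge0 // ltW.
have b1 : l * (K * p) <= l * (5 * l) by rewrite ler_wpM2l.
have b2 : l * (5 * l) <= 20 * lg ^+ 2.
  have : l * l <= (2 * lg) * (2 * lg) by rewrite ler_pM.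
  by rewrite expr2; lra.
have b3 : (l * (K * p)) ^+ 2 <= (20 * lg ^+ 2) ^+ 2.
  by rewrite ler_pXn2r ?nnegrE //; [lra|rewrite mulr_ge0 ?sqr_ge0].
have e4 : (20 * lg ^+ 2) ^+ 2 = 400%:R * lg ^+ 4 by ring.
rewrite e4 in b3; have : 0 <= lg ^+ 4 by rewrite exprn_ge0 //; lra.
lra.
Qed.

(** Only a polynomial part of the exponential in [p0] is kept. With [y] the cube root of [ln n], the
    bound [z <= expR z] at [z = y ^ 2 / 2], raised to the power 8, gives [y ^ 16 / 256]. The
    resulting [y ^ 14] exceeds the needed [(ln n) ^ 4 = y ^ 12] by a factor [y ^ 2], which absorbs
    constants. *)
Lemma density_bound n p : 1 <= ln (n%:R : R) ->
  2 / ln (n%:R : R) `^ (1 / 3) * p0 R n <= p ->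
  (ln (n%:R : R) `^ (1 / 3)) ^+ 14 / 64%:R <= n%:R * p ^+ 2.
Proof.
set lg := ln n%:R => lg1; set y := lg `^ (1 / 3) => le.
have lg0 : 0 <= lg by lra.
have n1 : (1 < n)%N by apply: ln_gt0_nat; rewrite -/lg; lra.
have n0 : 0 < n%:R :> R by rewrite ltr0n ltnW.
have y0 : 0 < y by rewrite powR_gt0 //; lra.
have y2 : lg `^ (2 / 3) = y ^+ 2.
  by rewrite -powR_mulrn ?ltW // /y -powRrM; congr (_ `^ _); lra.
have n2 : ((n%:R : R) `^ (1 / 2)) ^+ 2 = n%:R.
  by rewrite -powR_mulrn ?powR_ge0 // -powRrM div1r mulVf ?powRr1 ?ler0n // pnatr_eq0.
have b : 0 <= 2 / y * p0 R n by rewrite !mulr_ge0 ?invr_ge0 ?expR_ge0 ?powR_ge0 ?ltW.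
apply: (@le_trans _ _ (n%:R * (2 / y * p0 R n) ^+ 2)); last first.
  by rewrite ler_pM2l // ler_pXn2r ?nnegrE // (le_trans b).
rewrite /p0 -/lg y2.
have -> : n%:R * (2 / y * (expR (2 * y ^+ 2) / n%:R `^ (1 / 2))) ^+ 2 =
    4 * expR (2 * y ^+ 2) ^+ 2 / y ^+ 2.
  rewrite !exprMn !exprVn n2; field.
  by rewrite !gt_eqF.
have e8 : expR (2 * y ^+ 2) ^+ 2 = expR (y ^+ 2 / 2) ^+ 8.
  by rewrite -!expRM_natl; congr expR; field.
have e1 : (y ^+ 2 / 2) ^+ 8 <= expR (y ^+ 2 / 2) ^+ 8.
  have yy : 0 <= y ^+ 2 / 2 by rewrite divr_ge0 ?sqr_ge0.
  apply: lerXn2r; [by rewrite nnegrE|by rewrite nnegrE expR_ge0|].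
  by apply: le_trans (expR_ge1Dx _); lra.
rewrite e8 ler_pdivlMr ?exprn_gt0 //; apply: le_trans (ler_wpM2l _ e1) => //.
by rewrite le_eqVlt; apply/orP; left; apply/eqP; field.
Qed.

Lemma disconnected_small n (p1 p2 : R) :
  p1 <= 1 -> p2 <= 1 -> 1 <= ln (n%:R : R) ->
  200%:R * 200%:R * 1000%:R * 64%:R <= ln (n%:R : R) `^ (1 / 3) ->
  2 / ln (n%:R : R) `^ (1 / 3) * p0 R n <= p1 ->
  2 / ln (n%:R : R) `^ (1 / 3) * p0 R n <= p2 ->
  prob_FS_disconnected n p1 p2 <= 7 / n%:R.
Proof.
set lg := ln n%:R => p11 p21 lg1; set y := lg `^ (1 / 3); set b := 2 / y * _ => y1 le1 le2.
have lg0 : 0 <= lg by lra.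
have n1 : (1 < n)%N by apply: ln_gt0_nat; rewrite -/lg; lra.
have n0 : 0 < n%:R :> R by rewrite ltr0n ltnW.
have b0 : 0 < b by rewrite !mulr_gt0 ?invr_gt0 ?expR_gt0 ?powR_gt0 //; lra.
have y3 : y ^+ 3 = lg.
  by rewrite -powR_mulrn ?powR_ge0 // /y -powRrM div1r mulVf ?powRr1 // pnatr_eq0.
have := density_bound lg1 (lexx b); rewrite -/lg -/y => dens.
have [|k [L [L0 nL pL nk]]] := parameters_exist b0 (le_trans le1 p11) lg1.
  apply: le_trans dens; rewrite -/lg -y3 -exprM -[(3 * 4)%N]/12%N.
  have -> : y ^+ 14 = y ^+ 2 * y ^+ 12 by rewrite -exprD.
  rewrite [leRHS]mulrAC ler_pM2r; last by rewrite exprn_gt0 //; lra.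
  rewrite ler_pdivlMr ?ltr0n //; apply: (le_trans y1).
  by rewrite expr2 ler_peMr //; lra.
apply: le_trans (prob_disconnected_small b0 le1 le2 p11 p21 L0 nL pL nk) _.
rewrite ler_wpM2l // expRN lef_pV2 ?posrE ?expR_gt0 //.
Qed.

(** [c] is the Chernoff exponent per unit of the mean [n p]. The lower bound on [p] makes [c n p] at
    least [2 ln n], so each vertex fails with probability at most [n ^ -2]. *)
Lemma pr_high_degree_small n p (dl c : R) : let x := 1 + dl / 2 in
  0 < dl -> c = (1 + dl) * (1 - x^-1) - (x - 1) -> (1 < n)%N -> 0 <= p <= 1 -> 0 < c ->
  ln (n%:R : R) / n%:R <= c / 2 * p ->
  pr (all_pairs n) p (high_degree (Num.truncn ((1 + dl) * (n%:R * p))).+1) <= n%:R^-1.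
Proof.
move=> x dl0 cE n1 p01 c0 lnp; have [p0 p1] := andP p01.
have n0 : 0 < n%:R :> R by rewrite ltr0n ltnW.
have x1 : 1 < x by rewrite /x; lra.
have xi : 0 <= 1 - x^-1 by rewrite subr_ge0 invf_le1; lra.
set k := (Num.truncn _).+1.
have kgt : (1 + dl) * (n%:R * p) <= k%:R by rewrite ltW // truncnS_gt.
apply: le_trans (@pr_high_degree_exp _ n p x k p01 x1) _.
have lnp' : 2 * ln (n%:R : R) <= c * (n%:R * p).
  by move: lnp; rewrite ler_pdivrMr //; lra.
have e : p * n%:R * (x - 1) - k%:R * (1 - x^-1) <= - (2 * ln (n%:R : R)).
  have : (1 + dl) * (n%:R * p) * (1 - x^-1) <= k%:R * (1 - x^-1) by rewrite ler_wpM2r.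
  rewrite cE in lnp'; move: (x^-1) lnp' => z; nra.
apply: (@le_trans _ _ (n%:R * expR (- (2 * ln (n%:R : R))))).
  by rewrite ler_wpM2l // ler_expR.
rewrite expRN mulrDl mul1r expRD lnK ?posrE //.
by rewrite invfM mulrA mulfV ?mul1r // gt_eqF.
Qed.

(** With high probability the maximum degrees are at most [1 + dl] times [n p1] and [n p2]; twice
    their product is then below [n], and the graphs pack. *)
Lemma connected_small_packing n (p1 p2 dl e c : R) : let x := 1 + dl / 2 in
  0 < dl -> c = (1 + dl) * (1 - x^-1) - (x - 1) -> 0 < c -> (1 + dl) ^+ 2 * (1 - e) < 1 -> e <= 1 ->
  (1 < n)%N -> 0 <= p1 <= 1 -> 0 <= p2 <= 1 ->
  ln (n%:R : R) / n%:R <= c / 2 * p1 -> ln (n%:R : R) / n%:R <= c / 2 * p2 ->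
  p1 * p2 <= (1 - e) / 2 / n%:R ->
  prob_FS_connected n p1 p2 <= 2 / n%:R.
Proof.
move=> x dl0 cE c0 de e1 n1 p1_01 p2_01 ln1 ln2 p12.
have n0 : 0 < n%:R :> R by rewrite ltr0n ltnW.
apply: le_trans (prob_connected_packing n1 (d1 := Num.truncn ((1 + dl) * (n%:R * p1)))
  (d2 := Num.truncn ((1 + dl) * (n%:R * p2))) p1_01 p2_01 _) _; last first.
  by rewrite [leRHS]mulr_natl mulr2n; apply: lerD; apply: (pr_high_degree_small dl0 cE).
have [p1_0 _] := andP p1_01; have [p2_0 _] := andP p2_01.
have t1 : 0 <= (1 + dl) * (n%:R * p1) by rewrite !mulr_ge0 //; lra.
have t2 : 0 <= (1 + dl) * (n%:R * p2) by rewrite !mulr_ge0 //; lra.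
rewrite -(ltr_nat R) !natrM.
apply: (@le_lt_trans _ _ (2 * (((1 + dl) * (n%:R * p1)) * ((1 + dl) * (n%:R * p2))))).
  by rewrite ler_wpM2l // ler_pM // truncn_le.
have -> : 2 * (((1 + dl) * (n%:R * p1)) * ((1 + dl) * (n%:R * p2))) =
   (1 + dl) ^+ 2 * n%:R * (2 * n%:R * (p1 * p2)) by ring.
have b : 2 * n%:R * (p1 * p2) <= 1 - e.
  by move: p12; rewrite ler_pdivlMr //; lra.
apply: (@le_lt_trans _ _ ((1 + dl) ^+ 2 * n%:R * (1 - e))).
  by rewrite ler_wpM2l // mulr_ge0 ?sqr_ge0.
by rewrite mulrAC gtr_pMl.
Qed.

Lemma connected_small_isolated n (p1 p2 c : R) :
  0 <= p1 <= 1 -> 0 <= p2 <= 1 -> 54%:R <= ln (n%:R : R) -> c <= 0 ->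
  Num.min p1 p2 <= (ln (n%:R : R) + c) / n%:R ->
  prob_FS_connected n p1 p2 <= expR (c + 2) + (ln (n%:R : R))^-1.
Proof.
move=> p1_01 p2_01; set lg := ln n%:R => lg54 c0; set q := Num.min p1 p2 => qle.
have n1 : (1 < n)%N by apply: ln_gt0_nat; rewrite -/lg; lra.
have n0 : 0 < n%:R :> R by rewrite ltr0n ltnW.
have q0 : 0 <= q by rewrite le_min; case/andP: p1_01 => -> _; case/andP: p2_01 => -> _.
have nE : n%:R = expR lg by rewrite lnK.
have lg3 : lg ^+ 3 <= 27%:R * n%:R.
  have -> : n%:R = expR (lg / 3) ^+ 3 :> R by rewrite -expRM_natl nE; congr expR; field.
  have -> : lg ^+ 3 = 27%:R * (lg / 3) ^+ 3 by field.
  rewrite ler_wpM2l //; apply: lerXn2r; [by rewrite nnegrE; lra|by rewrite nnegrE expR_ge0|].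
  by apply: le_trans (expR_ge1Dx _); lra.
rewrite ler_pdivlMr // in qle.
(* Since [q n <= lg] and [lg ^ 3 <= 27 n], the product [q lg ^ 2] is at most 27, and [lg >= 54]
   gives one half. *)
have qlg : q * lg <= 1 / 2.
  have : q * n%:R * lg ^+ 2 <= lg * lg ^+ 2 by rewrite ler_wpM2r ?sqr_ge0 //; lra.
  rewrite -exprS => h; have : q * lg * (lg * n%:R) <= 27%:R * n%:R by lra.
  rewrite mulrA ler_pM2r // => h2.
  have : q * lg * 54%:R <= q * lg * lg by rewrite ler_wpM2l // mulr_ge0 //; lra.
  lra.
have q1 : q <= 1 / 108%:R.
  have : q * 54%:R <= q * lg by rewrite ler_wpM2l.
  lra.
have r0 : 0 < 1 - q by lra.
apply: le_trans (prob_connected_isolated n1 p1_01 p2_01 _) _; rewrite -/q; first by lra.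
apply: lerD; last first.
  rewrite ler_pdivrMr // mulrC ler_pdivlMr; last by lra.
  lra.
rewrite -[leRHS]invrK -expRN lef_pV2 ?posrE ?expR_gt0 //; last by rewrite mulr_gt0 ?exprn_gt0.
(* This turns [(1 - q) ^ n] into an exponential. The excess of [n q / (1 - q)] over [n q] is at most
   2, whence the [c + 2]. *)
have r1 : expR (- (q / (1 - q))) <= 1 - q.
  rewrite expRN -[leRHS]invrK lef_pV2 ?posrE ?expR_gt0 ?invr_gt0 //.
  apply: le_trans (expR_ge1Dx _); rewrite le_eqVlt; apply/orP; left; apply/eqP.
  by field; rewrite gt_eqF.
apply: (@le_trans _ _ (expR lg * expR (- (q / (1 - q))) ^+ n)).
  rewrite -expRM_natl -expRD ler_expR.
  have : n%:R * (q / (1 - q)) <= lg + c + 2; last by lra.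
  have -> : n%:R * (q / (1 - q)) = q * n%:R + q * n%:R * q / (1 - q) by field; rewrite gt_eqF.
  have : q * n%:R * q / (1 - q) <= 2; last by lra.
  rewrite ler_pdivrMr //; have : q * n%:R * q <= lg * q by rewrite ler_wpM2r //; lra.
  by lra.
rewrite -nE ler_wpM2l //; apply: (@le_trans _ _ ((1 - q) ^+ n)).
  by apply: lerXn2r; rewrite ?nnegrE ?expR_ge0 // ltW.
by apply: ler_wiXn2l; rewrite ?leq_pred //; lra.
Qed.

End Asymptotics.

(** * The limits *)

Lemma prob_sum (R : realType) n (p1 p2 : R) :
  prob_FS_connected n p1 p2 + prob_FS_disconnected n p1 p2 = 1.
Proof. exact: joint_compl. Qed.

Unset Implicit Arguments.

Theorem theorem2 (R : realType) (eps : R) (p1 p2 : nat -> R) :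
  0 < eps ->
  (forall n, 0 <= p1 n <= 1) -> (forall n, 0 <= p2 n <= 1) ->
  (* Part 1: disconnected w.h.p. *)
  ( ( ( (\forall n \near \oo,
           p1 n * p2 n <= ((1 - eps) / 2) / (n%:R : R))
        /\ (forall c : R, 0 < c ->
              \forall n \near \oo, ln (n%:R : R) / (n%:R : R) <= c * p1 n)
        /\ (forall c : R, 0 < c ->
              \forall n \near \oo, ln (n%:R : R) / (n%:R : R) <= c * p2 n) )
      \/
      (exists c : nat -> R, c @ \oo --> -oo /\
         \forall n \near \oo,
           Num.min (p1 n) (p2 n) <= (ln (n%:R : R) + c n) / (n%:R : R)) )
    -> (fun n => prob_FS_disconnected n (p1 n) (p2 n)) @ \oo --> (1 : R) )
  /\
  (* Part 2: connected w.h.p. *)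
  ( (\forall n \near \oo,
       [/\ p1 n * p2 n >= p0 R n ^+ 2,
           p1 n >= 2 / (ln (n%:R : R)) `^ (1 / 3) * p0 R n &
           p2 n >= 2 / (ln (n%:R : R)) `^ (1 / 3) * p0 R n])
    -> (fun n => prob_FS_connected n (p1 n) (p2 n)) @ \oo --> (1 : R) ).
Proof.
move=> eps0 p1_01 p2_01.
have conn_ge0 n : 0 <= prob_FS_connected n (p1 n) (p2 n) by exact: joint_ge0.
have disc_ge0 n : 0 <= prob_FS_disconnected n (p1 n) (p2 n) by exact: joint_ge0.
have to_disc : (forall e : R, 0 < e -> \forall n \near \oo, prob_FS_connected n (p1 n) (p2 n) <= e) ->
    (fun n => prob_FS_disconnected n (p1 n) (p2 n)) @ \oo --> (1 : R).
  move=> small; apply/cvgrPdist_le => e e0; have := small e e0; apply: filterS => n.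
  by rewrite -(@prob_sum R n (p1 n) (p2 n)) addrK ger0_norm.
have inv_small (C e : R) n : 0 < e -> 0 < C -> C / e <= ln (n%:R : R) -> C / n%:R <= e.
  move=> e0 C0 le; have le' := le_trans le (ln_le_nat R n).
  have n0 : 0 < n%:R :> R by apply: lt_le_trans le'; rewrite divr_gt0.
  by rewrite ler_pdivrMr // mulrC -ler_pdivrMr.
split; last first.
  move=> dense; apply/cvgrPdist_le => e e0.
  (* The constant is cubed because it must stay below the cube root of [ln n]. *)
  have near_y := near_ln ((200%:R * 200%:R * 1000%:R * 64%:R : R) ^+ 3).
  near=> n.
  have : [/\ p1 n * p2 n >= p0 R n ^+ 2,
           p1 n >= 2 / (ln (n%:R : R)) `^ (1 / 3) * p0 R n &
           p2 n >= 2 / (ln (n%:R : R)) `^ (1 / 3) * p0 R n] by near: n.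
  case=> _ le1 le2.
  have y3 : (200%:R * 200%:R * 1000%:R * 64%:R : R) ^+ 3 <= ln n%:R by near: n.
  rewrite -(@prob_sum R n (p1 n) (p2 n)) addrC addKr ger0_norm //.
  apply: (@le_trans _ _ (7 / n%:R)); last first.
    apply: inv_small => //; near: n; exact: near_ln.
  apply: disconnected_small => //; try by case/andP: (p1_01 n); try by case/andP: (p2_01 n).
    apply: le_trans y3; lra.
  set C := _ * _ * _ * _ in y3 *.
  have C0 : 0 <= C by rewrite /C; lra.
  have -> : C = (C ^+ 3) `^ (1 / 3).
    by rewrite -powR_mulrn // -powRrM mulrC div1r mulVf ?powRr1 // pnatr_eq0.
  have C3 : 0 <= C ^+ 3 by rewrite exprn_ge0.
  by apply: ge0_ler_powR; rewrite ?nnegrE ?divr_ge0 // (le_trans C3).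
case=> [[p12 [big1 big2]]|[c [c_oo pmin]]]; apply: to_disc => e e0.
  (* Truncation at 1 keeps [1 - e'] nonnegative, and it only weakens the bound on [p1 n * p2 n]. *)
  pose e' := Num.min eps 1; have e'0 : 0 < e' by rewrite lt_min eps0 ltr01.
  have e'1 : e' <= 1 by rewrite ge_min lexx orbT.
  have e'e : e' <= eps by rewrite ge_min lexx.
  (* With this [dl], the square of [1 + dl] is at most [1 + e']; and [x] lies strictly between 1 and
     [1 + dl], which makes [k] positive. *)
  pose dl := e' / 4; pose x := 1 + dl / 2.
  pose k := (1 + dl) * (1 - x^-1) - (x - 1).
  have dl0 : 0 < dl by rewrite /dl; lra.
  have k0 : 0 < k.
    have x0 : 0 < x by rewrite /x; lra.
    have -> : k = (x - 1) * (1 + dl - x) / x by rewrite /k; field; rewrite gt_eqF.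
    by rewrite divr_gt0 // mulr_gt0 //; rewrite /x; lra.
  have de : (1 + dl) ^+ 2 * (1 - e') < 1.
    have : (1 + dl) ^+ 2 <= 1 + e' by rewrite /dl; nra.
    by move=> h; apply: (@le_lt_trans _ _ ((1 + e') * (1 - e'))); [rewrite ler_wpM2r; lra|nra].
  have k2 : 0 < k / 2 by lra.
  have b1 := big1 _ k2; have b2 := big2 _ k2.
  near=> n.
  have n1 : (1 < n)%N by near: n; exact: nbhs_infty_ge.
  apply: (@le_trans _ _ (2 / n%:R)); last by apply: inv_small => //; near: n; exact: near_ln.
  apply: (@connected_small_packing R n (p1 n) (p2 n) dl e' k) => //.
  - by near: n.
  - by near: n.
  - apply: (@le_trans _ _ ((1 - eps) / 2 / n%:R)); first by near: n.
    by rewrite ler_wpM2r // ?invr_ge0 //; lra.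
have c_le A : \forall n \near \oo, c n <= A by apply/cvgrNyPle: A.
near=> n.
apply: (@le_trans _ _ (expR (c n + 2) + (ln (n%:R : R))^-1)).
  apply: connected_small_isolated => //.
  - by near: n; exact: near_ln.
  - by near: n.
  - by near: n.
have h1 : expR (c n + 2) <= e / 2.
  have : c n <= ln (e / 2) - 2 by near: n.
  by move=> h; rewrite -[leRHS]lnK ?posrE ?divr_gt0 // ler_expR; lra.
have h2 : (ln (n%:R : R))^-1 <= e / 2.
  have h : (e / 2)^-1 <= ln (n%:R : R) by near: n; exact: near_ln.
  by rewrite -[leRHS]invrK lef_pV2 // posrE ?invr_gt0 ?divr_gt0 // (lt_le_trans _ h) // invr_gt0 divr_gt0.
by rewrite [e]splitr; apply: lerD.
Unshelve. all: by end_near.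
Qed.
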